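(* Let $x_0\in\mathbb{R}$ and consider, for $u_0\in\mathbb{R}$, the Cauchy problem $$\frac{d}{dx}u(x)-N(x,u(x))\,u(x)=\phi(x),\quad x\in[x_0,+\infty),\qquad u(x_0)=u_0. \qquad (\ast)$$ Assume the following. 1. $N(x,u)=\sum_{i=0}^{\infty}a_i(x)u^i$, where $a_i\in C([x_0,+\infty))$, and there is a sequence of real numbers $B_i\ge 0$, $i=0,1,\ldots$, such that $\sup_{x\in[x_0,+\infty)}|a_i(x)|\le B_i$ for all $i=0,1,\ldots$, and the series $\sum_{i=0}^{\infty}B_iu^i$ converges for every $u\in\mathbb{R}$. 2. $\phi$ is continuous and bounded on $[x_0,+\infty)$, with $\sup_{x\in[x_0,+\infty)}|\phi(x)|=k<+\infty$. 3. There is a real number $\alpha>0$ such that $\left(N(x,u)u\right)'_u=N(x,u)+uN'_u(x,u)<-\alpha<0$ for all $x\in[x_0,+\infty)$ and all $u\in\mathbb{R}$. Then for any initial value $u_0\in\mathbb{R}$ the solution $u(x)$ of $(\ast)$ exists on $[x_0,+\infty)$, and the FD-method for $(\ast)$ converges on $[x_0,+\infty)$ to the exact solution of $(\ast)$. Moreover, there exist positive real numbers $\varepsilon, R, C$, depending only on the input data of the problem, such that, for the partial sums $\overset{m}{u}(x)=\sum_{i=0}^{m}u^{(i)}(x)$, $m=0,1,2,\ldots$, of the FD-method on a grid with maximal step $h$, $$\sup_{x\in[x_0,+\infty)}\left|u(x)-\overset{m}{u}(x)\right|\le\frac{C}{(1+m)^{1+\varepsilon}}\,\frac{(h/R)^{m+1}}{1-h/R}\quad\text{if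 } h<R,$$ $$\sup_{x\in[x_0,+\infty)}\left|u(x)-\overset{m}{u}(x)\right|\le C\sum_{j=m+1}^{\infty}\frac{1}{(j+1)^{1+\varepsilon}}\quad\text{if } h=R.$$
   Context: Grid. A grid is a sequence $\widehat\omega=\{x_0<x_1<x_2<\ldots\}$ with $x_n\to+\infty$ as $n\to+\infty$; put $h_i=x_i-x_{i-1}$ and $h=\sup_{i\in\mathbb{N}}h_i$ (the maximal step). Adomian polynomials. For a function $N(x,u)$ that is infinitely differentiable in $u$, $$A_k\left(N(x,(\cdot));u^{(0)},u^{(1)},\ldots,u^{(k)}\right)=\frac{1}{k!}\left.\frac{d^k}{dt^k}N\left(x,\sum_{i=0}^{\infty}t^iu^{(i)}\right)\right|_{t=0},$$ which depends only on $u^{(0)},\ldots,u^{(k)}$. FD-method. Given a grid, the terms $u^{(j)}\in C([x_0,+\infty))$, $j=0,1,2,\ldots$, are defined recursively as the continuous solutions on $[x_0,+\infty)$ (continuity at each $x_i$ being the matching condition) of the following linear problems. The term $u^{(0)}$ satisfies $$\frac{d}{dx}u^{(0)}(x)-N(x,u^{(0)}(x_{i-1}))\,u^{(0)}(x)=\phi(x),\quad x\in[x_{i-1},x_i],\ i=1,2,\ldots,\qquad u^{(0)}(x_0)=u_0,$$ and for $j=0,1,\ldots$ the term $u^{(j+1)}$ satisfies $$\frac{d}{dx}u^{(j+1)}(x)-N(x,u^{(0)}(x_{i-1}))\,u^{(j+1)}(x)=N'_u(x,u^{(0)}(x_{i-1}))\,u^{(0)}(x)\,u^{(j+1)}(x_{i-1})+F^{(j+1)}(x),$$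 for $x\in[x_{i-1},x_i]$, $i=1,2,\ldots$, with $u^{(j+1)}(x_0)=0$. Here $N'_u=\partial N/\partial u$, and for $x\in[x_{i-1},x_i]$ $$F^{(j+1)}(x)=\sum_{p=1}^{j}A_{j+1-p}\left(N(x,(\cdot));u^{(0)}(x_{i-1}),\ldots,u^{(j+1-p)}(x_{i-1})\right)u^{(p)}(x)$$ $$+\sum_{p=0}^{j}\Big[A_{j-p}\left(N(x,(\cdot));u^{(0)}(x),\ldots,u^{(j-p)}(x)\right)-A_{j-p}\left(N(x,(\cdot));u^{(0)}(x_{i-1}),\ldots,u^{(j-p)}(x_{i-1})\right)\Big]u^{(p)}(x)$$ $$+A_{j+1}\left(N(x,(\cdot));u^{(0)}(x_{i-1}),\ldots,u^{(j)}(x_{i-1}),0\right)u^{(0)}(x).$$ On each $[x_{i-1},x_i]$ the equations are understood with one-sided derivatives at the endpoints. Convergence of the FD-method. The FD-method for $(\ast)$ converges to the exact solution of $(\ast)$ on $[x_0,x_0+H)$, $0<H\le+\infty$, if there exists a real number $\overline{h}>0$ such that for any grid with $h\le\overline{h}$ the series $\sum_{i=0}^{\infty}u^{(i)}(x)$, whose terms are the continuous functions on $[x_0,+\infty)$ determined on that grid by $\frac{d}{dx}u^{(0)}(x)-N(x,u^{(0)}(x_{i-1}))\,u^{(0)}(x)=\phi(x)$, $u^{(0)}(x_0)=u_0$, and, for $j=0,1,\ldots$, by $\frac{d}{dx}u^{(j+1)}(x)-N(x,u^{(0)}(x_{i-1}))\,u^{(j+1)}(x)=N'_u(x,u^{(0)}(x_{i-1}))\,u^{(0)}(x)\,u^{(j+1)}(x_{i-1})+F^{(j+1)}(x)$,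 $u^{(j+1)}(x_0)=0$ (for $x\in[x_{i-1},x_i]$, $i=1,2,\ldots$), converges uniformly on $[x_0,x_0+H)$ to the exact solution of $(\ast)$. Convergence on $[x_0,+\infty)$ is the case $H=+\infty$. *)

(* Defs.v *)
From Stdlib Require Import Reals Factorial.
From Coquelicot Require Import Coquelicot.
Open Scope R_scope.

Definition ray (x0 : R) : R -> Prop := fun x => x0 <= x.

Definition sup_abs (x0 : R) (f : R -> R) : Rbar :=
  Lub_Rbar (fun y => exists x, ray x0 x /\ y = Rabs (f x)).

(* [D_in] takes the limit of the difference quotient within the set [D], so at
   an endpoint of an interval [D] the derivative is one-sided. *)
Definition derivative_on (D : R -> Prop) (f f' : R -> R) : Prop :=
  forall x, D x -> D_in f f' D x.

Definition solves_cauchy (N : R -> R -> R) (phi : R -> R) (x0 u0 : R)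
    (u : R -> R) : Prop :=
  derivative_on (ray x0) u (fun x => N x (u x) * u x + phi x) /\ u x0 = u0.

Definition is_grid (x0 : R) (g : nat -> R) : Prop :=
  g 0%nat = x0 /\ (forall i, g i < g (S i)) /\ is_lim_seq g p_infty.

Definition cell (g : nat -> R) (i : nat) : R -> Prop :=
  fun x => g i <= x <= g (S i).

Definition max_step (g : nat -> R) : Rbar :=
  Sup_seq (fun i => Finite (g (S i) - g i)).

(* A_k(f; v_0, ..., v_k).  The powers of [t] above [k] do not contribute to the
   [k]-th derivative at [0], so the series in [t] is cut at [k]: only
   v_0, ..., v_k enter, and no convergence question arises. *)
Definition adomian (k : nat) (f : R -> R) (v : nat -> R) : R :=
  / INR (fact k) * Derive_n (fun t => f (sum_n (fun i => t ^ i * v i) k)) k 0.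

(* F^(j+1)(x) on a grid cell with left endpoint [s].  Only u^(0), ..., u^(j)
   are used.  [sum_n_m _ 1 0] is the empty sum. *)
Definition FD_F (N : R -> R -> R) (u : nat -> R -> R) (j : nat) (s x : R) : R :=
  sum_n_m (fun p => adomian (S j - p) (N x) (fun i => u i s) * u p x) 1 j
  + sum_n (fun p => (adomian (j - p) (N x) (fun i => u i x)
                     - adomian (j - p) (N x) (fun i => u i s)) * u p x) j
  + adomian (S j) (N x) (fun i => if Nat.leb i j then u i s else 0) * u 0%nat x.

Definition FD_terms (N : R -> R -> R) (phi : R -> R) (x0 u0 : R)
    (g : nat -> R) (u : nat -> R -> R) : Prop :=
  (forall j, continuous_on (ray x0) (u j)) /\
  u 0%nat x0 = u0 /\
  (forall i, derivative_on (cell g i) (u 0%nat)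
     (fun x => N x (u 0%nat (g i)) * u 0%nat x + phi x)) /\
  (forall j, u (S j) x0 = 0) /\
  (forall j i, derivative_on (cell g i) (u (S j))
     (fun x => N x (u 0%nat (g i)) * u (S j) x
               + (Derive (N x) (u 0%nat (g i)) * u 0%nat x * u (S j) (g i)
                  + FD_F N u j (g i) x))).

Definition partial_sum (u : nat -> R -> R) (m : nat) (x : R) : R :=
  sum_n (fun i => u i x) m.

Definition converges_uniformly_on (D : R -> Prop) (f : nat -> R -> R)
    (l : R -> R) : Prop :=
  forall eps : R, 0 < eps ->
    eventually (fun m => forall x, D x -> Rabs (f m x - l x) < eps).

(* Convergence on [x0, x0 + H) to [u], the exact solution there.  The terms are
   given by a relation, determining them only on [ray x0]; existence is required
   so that the convergence requirement is not vacuous. *)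
Definition FD_converges (N : R -> R -> R) (phi : R -> R) (x0 u0 : R)
    (H : Rbar) (u : R -> R) : Prop :=
  exists hbar : R, 0 < hbar /\
    forall g, is_grid x0 g -> Rbar_le (max_step g) hbar ->
      (exists v, FD_terms N phi x0 u0 g v) /\
      forall v, FD_terms N phi x0 u0 g v ->
        converges_uniformly_on
          (fun x => x0 <= x /\ Rbar_lt x (Rbar_plus x0 H))
          (partial_sum v) u.

(* Main.v *)
Require Import Defs.
From Stdlib Require Import Reals Lra Lia Classical_Prop IndefiniteDescription.
From Coquelicot Require Import Coquelicot.
Open Scope R_scope.

(** Generating functions explain the method.  Write [U_x(t)] for the power series
    in [t] with coefficients [u j x], and [A_s(t)] for the one whose coefficients are
    the Adomian polynomials of [N x] at the values [u j s].  As [N x] is entire,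
    [A_s(t)] is the expansion of [N x (U_s(t))].  On the cell with left end [s] the
    right-hand sides of the linear problems are, up to [phi], the coefficients of
    [A_s(t) U_x(t) + t (A_x(t) - A_s(t)) U_x(t)] ([FD_rhs_S]).  At [t = 1] the values
    frozen at [s] cancel and [N x (U_x(1)) U_x(1)] remains, so the sum of the method
    solves the Cauchy problem once everything converges well enough
    ([FD_rhs_series], [FD_sum_solves]); this also provides the solution.

    For the convergence, fix [theta = h / r] and compare the terms with
    [theta ^ j / (j + 1) ^ 2].  These weights are closed under Cauchy products up to
    the factor 8 ([weight_conv]), hence under powers up to geometric factors, and
    the entire majorant of [N] absorbs those; so an Adomian polynomial of dominated
    terms is dominated by the same weights.  The source of term [j + 1] consists of
    products of two terms of positive index, and of differences between [x] and [s]
    that carry a factor [h].  If the terms of positive index are at most [delta]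
    times the weights, the first part is of order [delta ^ 2]; the second is of
    order [r], because [h] times the [j]-th weight is at most [4 r] times the next
    one ([weight_step]).  Choosing [delta] small and then [r] small, the induction
    closes ([next_term_bounded]), provided that a term is bounded by its source
    uniformly on the half-line.

    This last point is where the monotonicity of [N(x,u) u] enters.  It gives
    [N < - alpha] and makes the linear problems dissipative, except that part of the
    linearization acts on the value at [s]; the delay costs a factor [h].  All
    differential inequalities, uniqueness included, are reduced to one comparison
    principle, [barrier], in which a maximum with negative left derivative is
    impossible.

    The bounds sum to the error estimate, with [eps = 1] and with [C] a bound for
    the first term. *)

(** * Series depending on a parameter *)

Lemma filterlim_R {T : Type} (F : (T -> Prop) -> Prop) {FF : Filter F}
    (f : T -> R) (l : R) :
  filterlim f F (locally l) <->
  forall eps : R, 0 < eps -> F (fun x => Rabs (f x - l) < eps).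
Proof.
  split.
  - intros H eps Heps.
    exact (proj1 (filterlim_locally f l) H (mkposreal eps Heps)).
  - intros H. apply filterlim_locally. intros eps.
    exact (H eps (cond_pos eps)).
Qed.

Lemma ex_series_dominated (c b : nat -> R) :
  (forall i, Rabs (c i) <= b i) -> ex_series b ->
  ex_series (fun i => Rabs (c i)).
Proof.
  intros H Hb. apply (ex_series_le (fun i => Rabs (c i)) b); [|exact Hb].
  intros n. unfold norm; simpl; unfold abs; simpl. rewrite Rabs_Rabsolu. apply H.
Qed.

Lemma Series_tail (b : nat -> R) (n : nat) : ex_series b ->
  Series b = sum_n b n + Series (fun k => b (S n + k)%nat).
Proof.
  intros Hb. rewrite (Series_incr_n b (S n)) by (lia || exact Hb).
  rewrite <- sum_n_Reals. reflexivity.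
Qed.

Lemma series_remainder_le (c b : nat -> R) (n : nat) :
  (forall i, Rabs (c i) <= b i) -> ex_series b ->
  Rabs (Series c - sum_n c n) <= Series (fun k => b (S n + k)%nat).
Proof.
  intros H Hb.
  assert (Hc : ex_series (fun i => Rabs (c i))) by now apply ex_series_dominated with b.
  rewrite (Series_tail c n) by now apply ex_series_Rabs.
  replace (sum_n c n + _ - sum_n c n) with (Series (fun k => c (S n + k)%nat)) by ring.
  eapply Rle_trans.
  - apply Series_Rabs.
    exact (proj1 (ex_series_incr_n (fun i => Rabs (c i)) (S n)) Hc).
  - apply Series_le.
    + intros k. split; [apply Rabs_pos | apply H].
    + exact (proj1 (ex_series_incr_n b (S n)) Hb).
Qed.

Lemma series_tail_lt (b : nat -> R) (eps : R) : ex_series b -> 0 < eps ->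
  eventually (fun n => Series (fun k => b (S n + k)%nat) < eps).
Proof.
  intros Hb Heps.
  assert (H : filterlim (sum_n b) eventually (locally (Series b)))
    by exact (Series_correct b Hb).
  apply (proj1 (filterlim_R _ _ _)) with (eps := eps) in H; [|exact Heps].
  revert H. apply filter_imp. intros n Hn.
  rewrite (Series_tail b n Hb) in Hn. apply Rabs_def2 in Hn. lra.
Qed.

Lemma Series_abs_le (c b : nat -> R) :
  (forall i, Rabs (c i) <= b i) -> ex_series b -> Rabs (Series c) <= Series b.
Proof.
  intros H Hb.
  assert (Hc := ex_series_dominated c b H Hb).
  eapply Rle_trans; [apply Series_Rabs, Hc|].
  apply Series_le; [|exact Hb].
  intros k. split; [apply Rabs_pos | apply H].
Qed.

(** Tannery's theorem (dominated convergence for series) along an arbitrary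
    filter.  Along [eventually] it exchanges two summations; along
    [within D (locally x)] it gives continuity of a sum of functions. *)
Lemma tannery {T : Type} (F : (T -> Prop) -> Prop) {FF : Filter F}
    (c : T -> nat -> R) (l b : nat -> R) :
  ex_series b ->
  (forall n, filterlim (fun x => c x n) F (locally (l n))) ->
  (forall n, Rabs (l n) <= b n) ->
  F (fun x => forall n, Rabs (c x n) <= b n) ->
  filterlim (fun x => Series (c x)) F (locally (Series l)).
Proof.
  intros Hb Hlim Hl Hc. apply filterlim_R; [exact FF|]. intros eps Heps.
  destruct (series_tail_lt b (eps / 3) Hb) as [n Hn]; [lra|].
  specialize (Hn n (Nat.le_refl n)).
  assert (Hsum : filterlim (fun x => sum_n (c x) n) F (locally (sum_n l n))).
  { clear Hn. induction n as [|n IH].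
    - rewrite sum_O. apply filterlim_ext with (fun x => c x 0%nat); [|apply Hlim].
      intros x. now rewrite sum_O.
    - rewrite sum_Sn. apply filterlim_ext with (fun x => plus (sum_n (c x) n) (c x (S n))).
      + intros x. now rewrite sum_Sn.
      + eapply filterlim_comp_2; [apply IH | apply Hlim | apply (filterlim_plus (V := R_NormedModule))]. }
  apply (proj1 (filterlim_R _ _ _)) with (eps := eps / 3) in Hsum; [|lra].
  generalize (filter_and _ _ Hc Hsum). apply filter_imp. intros x [Hx Hs].
  assert (H1 := series_remainder_le (c x) b n Hx Hb).
  assert (H2 := series_remainder_le l b n Hl Hb).
  apply Rabs_def2 in Hs.
  apply Rabs_le_between in H1. apply Rabs_le_between in H2.
  apply Rabs_def1; lra.
Qed.

Lemma sum_n_Series (c : nat -> nat -> R) (J : nat) :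
  (forall j, ex_series (fun n => c n j)) ->
  is_series (fun n => sum_n (c n) J) (sum_n (fun j => Series (fun n => c n j)) J).
Proof.
  intros H. induction J as [|J IH].
  - rewrite sum_O. apply is_series_ext with (fun n => c n 0%nat).
    + intros n. now rewrite sum_O.
    + apply Series_correct, H.
  - rewrite sum_Sn. apply is_series_ext with (fun n => plus (sum_n (c n) J) (c n (S J))).
    + intros n. now rewrite sum_Sn.
    + apply (is_series_plus (V := R_NormedModule)); [exact IH | apply Series_correct, H].
Qed.

Lemma Rabs_le_Series_Rabs (c : nat -> R) (j : nat) :
  ex_series (fun i => Rabs (c i)) -> Rabs (c j) <= Series (fun i => Rabs (c i)).
Proof.
  intros H. rewrite (Series_tail _ j H).
  assert (0 <= Series (fun k => Rabs (c (S j + k)%nat))).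
  { assert (E := proj1 (ex_series_incr_n (fun i => Rabs (c i)) (S j)) H).
    eapply Rle_trans; [apply Rabs_pos | apply Series_Rabs; exact E]. }
  assert (Rabs (c j) <= sum_n (fun i => Rabs (c i)) j).
  { destruct j as [|j].
    - rewrite sum_O. apply Rle_refl.
    - rewrite sum_Sn. change plus with Rplus.
      assert (0 <= sum_n (fun i => Rabs (c i)) j); [|lra].
      rewrite sum_n_Reals. apply cond_pos_sum. intros; apply Rabs_pos. }
  lra.
Qed.

Lemma sum_Rabs_le_Series (c : nat -> R) (J : nat) :
  ex_series (fun i => Rabs (c i)) ->
  Rabs (sum_n c J) <= Series (fun i => Rabs (c i)).
Proof.
  intros H. rewrite (Series_tail _ J H).
  assert (0 <= Series (fun k => Rabs (c (S J + k)%nat))).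
  { assert (E := proj1 (ex_series_incr_n (fun i => Rabs (c i)) (S J)) H).
    eapply Rle_trans; [apply Rabs_pos | apply Series_Rabs; exact E]. }
  assert (Rabs (sum_n c J) <= sum_n (fun i => Rabs (c i)) J).
  { rewrite !sum_n_Reals. apply Rsum_abs. }
  lra.
Qed.

(** Fubini for series dominated along the rows: by Tannery's theorem, applied to the
    partial sums of the rows. *)
Lemma double_series (c : nat -> nat -> R) (b : nat -> R) :
  (forall n, ex_series (fun j => Rabs (c n j))) ->
  (forall n, Series (fun j => Rabs (c n j)) <= b n) ->
  ex_series b ->
  is_series (fun j => Series (fun n => c n j)) (Series (fun n => Series (c n))).
Proof.
  intros Hc Hle Hb.
  assert (Hcol : forall j, ex_series (fun n => c n j)).
  { intros j. apply ex_series_Rabs. apply ex_series_dominated with b; [|exact Hb].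
    intros n. eapply Rle_trans; [apply (Rabs_le_Series_Rabs (c n)), Hc | apply Hle]. }
  unfold is_series.
  apply filterlim_ext with (fun J => Series (fun n => sum_n (c n) J)).
  { intros J. apply is_series_unique. now apply sum_n_Series. }
  apply (tannery eventually (fun J n => sum_n (c n) J) (fun n => Series (c n)) b Hb).
  - intros n. exact (Series_correct _ (ex_series_Rabs _ (Hc n))).
  - intros n. eapply Rle_trans; [apply Series_Rabs, Hc | apply Hle].
  - exists 0%nat. intros J _ n.
    eapply Rle_trans; [apply sum_Rabs_le_Series, Hc | apply Hle].
Qed.

Lemma double_series_abs (c : nat -> nat -> R) (b : nat -> R) :
  (forall n, ex_series (fun j => Rabs (c n j))) ->
  (forall n, Series (fun j => Rabs (c n j)) <= b n) ->
  ex_series b ->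
  ex_series (fun j => Rabs (Series (fun n => c n j))).
Proof.
  intros Hc Hle Hb.
  apply ex_series_dominated with (fun j => Series (fun n => Rabs (c n j))).
  - intros j. apply Series_Rabs. apply ex_series_dominated with b; [|exact Hb].
    intros n. eapply Rle_trans; [apply (Rabs_le_Series_Rabs (c n)), Hc | apply Hle].
  - eexists. apply (double_series (fun n j => Rabs (c n j)) b); [| |exact Hb].
    + intros n. apply ex_series_ext with (fun j => Rabs (c n j)); [|apply Hc].
      intros j. now rewrite Rabs_Rabsolu.
    + intros n. rewrite (Series_ext _ (fun j => Rabs (c n j))); [apply Hle|].
      intros j. apply Rabs_Rabsolu.
Qed.

(** * Adomian polynomials of entire functions *)

(** [pow_coef v n k] is the coefficient of [t ^ k] in the [n]-th power of the series
    with coefficients [v]. *)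
Fixpoint pow_coef (v : nat -> R) (n : nat) : nat -> R :=
  match n with
  | O => fun k => match k with O => 1 | S _ => 0 end
  | S n => PS_mult v (pow_coef v n)
  end.

Definition drop_head (f : nat -> R) (i : nat) : R :=
  match i with O => 0 | S _ => f i end.

Definition truncate (k : nat) (v : nat -> R) (i : nat) : R :=
  if Nat.leb i k then v i else 0.

Lemma PS_mult_ext (f f' g g' : nat -> R) (k : nat) :
  (forall i, (i <= k)%nat -> f i = f' i) ->
  (forall i, (i <= k)%nat -> g i = g' i) ->
  PS_mult f g k = PS_mult f' g' k.
Proof.
  intros Hf Hg. apply sum_eq. intros i Hi.
  rewrite Hf by lia. rewrite Hg by lia. reflexivity.
Qed.

(** Isolates the two products in which the newest index [S k] occurs; in the rest
    both factors have positive index. *)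
Lemma PS_mult_ends (f g : nat -> R) (k : nat) :
  PS_mult f g (S k) = f 0%nat * g (S k) + f (S k) * g 0%nat
                      + PS_mult (drop_head f) (drop_head g) (S k).
Proof.
  unfold PS_mult.
  rewrite (decomp_sum _ (S k)) by lia. rewrite (decomp_sum (fun i => drop_head f i * _) (S k)) by lia.
  simpl pred. destruct k as [|k].
  - simpl. ring.
  - rewrite !tech5.
    rewrite (sum_eq (fun i => drop_head f (S i) * drop_head g (S (S k) - S i))
               (fun i => f (S i) * g (S (S k) - S i)%nat)).
    2:{ intros i Hi. replace (S (S k) - S i)%nat with (S (k - i)) by lia. reflexivity. }
    replace (S (S k) - 0)%nat with (S (S k)) by lia.
    replace (S (S k) - S (S k))%nat with 0%nat by lia. simpl drop_head. ring.
Qed.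

Lemma Rabs_PS_mult_le (f g p q : nat -> R) (k : nat) :
  (forall i, (i <= k)%nat -> Rabs (f i) <= p i) ->
  (forall i, (i <= k)%nat -> Rabs (g i) <= q i) ->
  Rabs (PS_mult f g k) <= PS_mult p q k.
Proof.
  intros Hf Hg. unfold PS_mult. eapply Rle_trans; [apply Rsum_abs|].
  apply sum_Rle. intros i Hi. rewrite Rabs_mult.
  apply Rmult_le_compat; try apply Rabs_pos; [apply Hf | apply Hg]; lia.
Qed.

Lemma PS_mult_scal (f g : nat -> R) (c d : R) (k : nat) :
  PS_mult (fun i => c * f i) (fun i => d * g i) k = c * d * PS_mult f g k.
Proof.
  unfold PS_mult. rewrite scal_sum. apply sum_eq. intros i Hi. ring.
Qed.

Lemma abs_conv_PS_mult (f g : nat -> R) :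
  ex_series (fun i => Rabs (f i)) -> ex_series (fun i => Rabs (g i)) ->
  ex_series (fun k => Rabs (PS_mult f g k)) /\
  Series (fun k => Rabs (PS_mult f g k))
    <= Series (fun i => Rabs (f i)) * Series (fun i => Rabs (g i)).
Proof.
  intros Hf Hg.
  assert (H : is_series (PS_mult (fun i => Rabs (f i)) (fun i => Rabs (g i)))
      (Series (fun i => Rabs (f i)) * Series (fun i => Rabs (g i)))).
  { apply is_series_mult_pos; try (now apply Series_correct);
      intros n; apply Rabs_pos. }
  assert (Hle : forall k, Rabs (PS_mult f g k)
      <= PS_mult (fun i => Rabs (f i)) (fun i => Rabs (g i)) k)
    by (intros k; apply Rabs_PS_mult_le; intros; apply Rle_refl).
  split.
  - apply ex_series_dominated with (1 := Hle). eexists; exact H.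
  - rewrite <- (is_series_unique _ _ H). apply Series_le.
    + intros k. split; [apply Rabs_pos | apply Hle].
    + eexists; exact H.
Qed.

Lemma pow_coef_ext (v w : nat -> R) (n k : nat) :
  (forall i, (i <= k)%nat -> v i = w i) -> pow_coef v n k = pow_coef w n k.
Proof.
  revert k. induction n as [|n IH]; intros k H; simpl; [reflexivity|].
  apply PS_mult_ext; [exact H|]. intros i Hi. apply IH. intros l Hl. apply H. lia.
Qed.

Lemma pow_coef_scale (v : nat -> R) (t : R) (n k : nat) :
  pow_coef (fun i => v i * t ^ i) n k = pow_coef v n k * t ^ k.
Proof.
  revert k. induction n as [|n IH]; intros k; simpl.
  - destruct k; simpl; ring.
  - unfold PS_mult. rewrite Rmult_comm, scal_sum. apply sum_eq. intros i Hi.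
    rewrite IH. replace (t ^ k) with (t ^ i * t ^ (k - i)); [ring|].
    rewrite <- pow_add. f_equal. lia.
Qed.

Lemma pow_coef_O (v : nat -> R) (n : nat) : pow_coef v n 0%nat = v 0%nat ^ n.
Proof.
  induction n as [|n IH]; simpl; [reflexivity|].
  unfold PS_mult. simpl. now rewrite IH.
Qed.

Lemma Series_finite (v : nat -> R) (k : nat) :
  (forall i, (k < i)%nat -> v i = 0) -> is_series v (sum_n v k).
Proof.
  intros H. unfold is_series.
  apply filterlim_ext_loc with (fun _ => sum_n v k); [|apply filterlim_const].
  exists k. intros n Hn. induction Hn as [|n Hn IH]; [reflexivity|].
  rewrite sum_Sn, <- IH, H by lia. symmetry. apply Rplus_0_r.
Qed.

Lemma is_series_delta :
  is_series (fun k : nat => match k with O => 1 | S _ => 0 end) 1.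
Proof.
  assert (H := Series_finite (fun k : nat => match k with O => 1 | S _ => 0 end) 0).
  rewrite sum_O in H. apply H. intros [|i] Hi; [lia | reflexivity].
Qed.

(** The multinomial theorem for absolutely convergent series, by repeated
    Cauchy products. *)
Lemma pow_coef_series (v : nat -> R) (n : nat) :
  ex_series (fun i => Rabs (v i)) ->
  is_series (pow_coef v n) (Series v ^ n) /\
  ex_series (fun k => Rabs (pow_coef v n k)) /\
  Series (fun k => Rabs (pow_coef v n k)) <= Series (fun i => Rabs (v i)) ^ n.
Proof.
  intros Hv. induction n as [|n [IH1 [IH2 IH3]]]; simpl.
  - assert (E : forall k : nat, match k with O => 1 | S _ => 0 end
      = Rabs (match k with O => 1 | S _ => 0 end)).
    { intros [|k]; [rewrite Rabs_R1 | rewrite Rabs_R0]; reflexivity. }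
    assert (H := is_series_ext _ _ _ E is_series_delta).
    split; [exact is_series_delta|]. split.
    + now exists 1.
    + rewrite (is_series_unique _ _ H). apply Rle_refl.
  - destruct (abs_conv_PS_mult v (pow_coef v n) Hv IH2) as [H1 H2].
    split; [|split].
    + apply is_series_mult; try assumption. apply Series_correct, ex_series_Rabs, Hv.
    + exact H1.
    + eapply Rle_trans; [exact H2|]. apply Rmult_le_compat_l; [|exact IH3].
      eapply Rle_trans; [apply Rabs_pos | apply Series_Rabs, Hv].
Qed.

Lemma CV_disk_le_radius (a : nat -> R) (r : R) :
  CV_disk a r -> Rbar_le r (CV_radius a).
Proof. intros H. now apply (proj1 (Lub_Rbar_correct (CV_disk a))). Qed.

Lemma adomian_ext (k : nat) (f : R -> R) (v w : nat -> R) :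
  (forall i, (i <= k)%nat -> v i = w i) -> adomian k f v = adomian k f w.
Proof.
  intros H. unfold adomian. f_equal. apply Derive_n_ext. intros t. f_equal.
  apply sum_n_ext_loc. intros i Hi. now rewrite H.
Qed.

Lemma adomian_O (f : R -> R) (v : nat -> R) : adomian 0 f v = f (v 0%nat).
Proof.
  unfold adomian. simpl. rewrite sum_O. simpl. rewrite Rinv_1, !Rmult_1_l.
  reflexivity.
Qed.

Section Entire.

Context (a B : nat -> R) (f : R -> R).
Context (a_le_B : forall n, Rabs (a n) <= B n).
Context (B_entire : forall u, ex_pseries B u).
Context (f_series : forall u, is_pseries a u (f u)).

Lemma B_pow_ex (s : R) : ex_series (fun n => B n * s ^ n).
Proof.
  destruct (B_entire s) as [l Hl]. exists l. now apply is_pseries_R.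
Qed.

Lemma coef_mult_le (d : nat -> R) (s : R) :
  (forall n, Rabs (d n) <= s ^ n) -> forall n, Rabs (a n * d n) <= B n * s ^ n.
Proof.
  intros H n. rewrite Rabs_mult.
  apply Rmult_le_compat; try apply Rabs_pos; [apply a_le_B | apply H].
Qed.

(** Composing an entire function with an absolutely convergent series: the
    double series over the powers [n] and the indices [j] is dominated by
    [B n * (sum |v i|) ^ n], so it may be summed in either order. *)
Lemma compose_series (v : nat -> R) :
  ex_series (fun i => Rabs (v i)) ->
  is_series (fun j => Series (fun n => a n * pow_coef v n j)) (f (Series v)) /\
  ex_series (fun j => Rabs (Series (fun n => a n * pow_coef v n j))).
Proof.
  intros Hv.
  assert (Hc : forall n, ex_series (fun j => Rabs (a n * pow_coef v n j))).
  { intros n. apply ex_series_ext with (fun j => Rabs (a n) * Rabs (pow_coef v n j)).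
    - intros j. now rewrite Rabs_mult.
    - apply (ex_series_scal (V := R_NormedModule)). now apply pow_coef_series. }
  assert (Hle : forall n, Series (fun j => Rabs (a n * pow_coef v n j))
     <= B n * Series (fun i => Rabs (v i)) ^ n).
  { intros n. rewrite (Series_ext _ (fun j => Rabs (a n) * Rabs (pow_coef v n j)))
      by (intros; apply Rabs_mult).
    rewrite Series_scal_l. destruct (pow_coef_series v n Hv) as [_ [H2 H3]].
    apply Rmult_le_compat; [apply Rabs_pos | | apply a_le_B | exact H3].
    eapply Rle_trans; [apply Rabs_pos | apply Series_Rabs, H2]. }
  split.
  - replace (f (Series v)) with (Series (fun n => Series (fun j => a n * pow_coef v n j))).
    + exact (double_series (fun n j => a n * pow_coef v n j) _ Hc Hle (B_pow_ex _)).
    + apply is_series_unique.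
      apply is_series_ext with (fun n => a n * Series v ^ n).
      * intros n. rewrite Series_scal_l. f_equal. symmetry.
        apply is_series_unique. now apply pow_coef_series.
      * now apply is_pseries_R.
  - exact (double_series_abs (fun n j => a n * pow_coef v n j) _ Hc Hle (B_pow_ex _)).
Qed.

(** Along the curve [t |-> sum t^i v_i] the composite is a power series in [t]
    whose coefficients are those of [compose_series]; its [k]-th derivative at
    the origin picks out the [k]-th one. *)
Lemma adomian_eq (k : nat) (v : nat -> R) :
  adomian k f v = Series (fun n => a n * pow_coef v n k).
Proof.
  pose (w := truncate k v).
  pose (A := fun j => Series (fun n => a n * pow_coef w n j)).
  assert (Hw : forall t, is_series (fun i => w i * t ^ i) (sum_n (fun i => t ^ i * v i) k)).
  { intros t.
    replace (sum_n (fun i => t ^ i * v i) k) with (sum_n (fun i => w i * t ^ i) k).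
    - apply Series_finite. intros i Hi. unfold w, truncate.
      rewrite (proj2 (Nat.leb_gt i k)) by lia. ring.
    - rewrite !sum_n_Reals. apply sum_eq. intros i Hi. unfold w, truncate.
      rewrite (proj2 (Nat.leb_le i k)) by lia. ring. }
  assert (Hwa : forall t, ex_series (fun i => Rabs (w i * t ^ i))).
  { intros t. eexists. apply Series_finite with (k := k). intros i Hi. unfold w, truncate.
    rewrite (proj2 (Nat.leb_gt i k)) by lia. rewrite Rmult_0_l. apply Rabs_R0. }
  assert (HA : forall t, is_series (fun j => A j * t ^ j) (f (sum_n (fun i => t ^ i * v i) k))
              /\ ex_series (fun j => Rabs (A j * t ^ j))).
  { intros t. rewrite <- (is_series_unique _ _ (Hw t)).
    destruct (compose_series _ (Hwa t)) as [H1 H2].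
    assert (E : forall j, Series (fun n => a n * pow_coef (fun i => w i * t ^ i) n j)
                        = A j * t ^ j).
    { intros j. unfold A. rewrite <- Series_scal_r. apply Series_ext. intros n.
      rewrite pow_coef_scale. ring. }
    split.
    - apply is_series_ext with (1 := E). exact H1.
    - apply ex_series_ext with (2 := H2). intros j. now rewrite E. }
  unfold adomian.
  rewrite (Derive_n_ext _ (PSeries A)).
  2:{ intros t. symmetry. apply is_pseries_unique, is_pseries_R, HA. }
  rewrite Derive_n_coef.
  2:{ apply Rbar_lt_le_trans with (Finite 1); [simpl; lra|].
      apply CV_disk_le_radius, HA. }
  unfold A. rewrite (Series_ext _ (fun n => a n * pow_coef v n k)).
  - field. apply INR_fact_neq_0.
  - intros n. f_equal. apply pow_coef_ext. intros i Hi. unfold w, truncate.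
    now rewrite (proj2 (Nat.leb_le i k)) by lia.
Qed.

Lemma adomian_series (v : nat -> R) :
  ex_series (fun i => Rabs (v i)) ->
  is_series (fun j => adomian j f v) (f (Series v)) /\
  ex_series (fun j => Rabs (adomian j f v)).
Proof.
  intros Hv. destruct (compose_series v Hv) as [H1 H2]. split.
  - apply is_series_ext with (2 := H1). intros j. now rewrite adomian_eq.
  - apply ex_series_ext with (2 := H2). intros j. now rewrite adomian_eq.
Qed.

Lemma pow_derive_le (u : R) (n : nat) :
  Rabs (INR n * u ^ pred n) <= (1 + Rabs u) ^ n.
Proof.
  rewrite Rabs_mult, (Rabs_pos_eq (INR n)) by apply pos_INR.
  rewrite <- RPow_abs. assert (Hu := Rabs_pos u). set (r := Rabs u) in *.
  clearbody r. clear - Hu.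
  destruct n as [|n]; [simpl; lra|]. simpl pred.
  induction n as [|n IH]; [simpl; lra|].
  rewrite S_INR.
  assert (r ^ S n <= (1 + r) ^ S n) by (apply pow_incr; lra).
  change ((1 + r) ^ S (S n)) with ((1 + r) * (1 + r) ^ S n).
  change (r ^ S n) with (r * r ^ n) in *.
  assert (INR (S n) * (r * r ^ n) <= r * (1 + r) ^ S n); [|lra].
  replace (INR (S n) * (r * r ^ n)) with (r * (INR (S n) * r ^ n)) by ring.
  now apply Rmult_le_compat_l.
Qed.

Lemma entire_is_derive (u : R) :
  is_derive f u (Series (fun n => a n * (INR n * u ^ pred n))).
Proof.
  assert (Hr : Rbar_lt (Rabs u) (CV_radius a)).
  { apply Rbar_lt_le_trans with (Finite (Rabs u + 1)); [simpl; lra|].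
    apply CV_disk_le_radius. apply ex_series_dominated with (2 := B_pow_ex (Rabs u + 1)).
    apply coef_mult_le. intros n. rewrite <- RPow_abs, Rabs_pos_eq; [apply Rle_refl|].
    assert (H := Rabs_pos u); lra. }
  apply is_derive_ext with (PSeries a).
  { intros t. now apply is_pseries_unique. }
  replace (Series _) with (PSeries (PS_derive a) u).
  { now apply is_derive_PSeries. }
  unfold PSeries, PS_derive.
  rewrite (Series_incr_1 (fun n => a n * (INR n * u ^ pred n))).
  - simpl INR at 2. rewrite Rmult_0_l, Rmult_0_r, Rplus_0_l.
    apply Series_ext. intros n. simpl pred. ring.
  - apply ex_series_Rabs. apply ex_series_dominated with (2 := B_pow_ex (1 + Rabs u)).
    apply coef_mult_le. intros n. apply pow_derive_le.
Qed.

Lemma entire_Derive (u : R) :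
  Derive f u = Series (fun n => a n * (INR n * u ^ pred n)).
Proof. apply is_derive_unique, entire_is_derive. Qed.

Lemma entire_Derive_le (u s : R) : 1 + Rabs u <= s ->
  Rabs (Derive f u) <= Series (fun n => B n * s ^ n).
Proof.
  intros Hs. rewrite entire_Derive. apply Series_abs_le; [|apply B_pow_ex].
  apply coef_mult_le. intros n. eapply Rle_trans; [apply pow_derive_le|].
  apply pow_incr. assert (H := Rabs_pos u); lra.
Qed.

(** In a monomial of total index [S k] the entry [v (S k)] occurs at most once, with
    all other factors equal to [v 0]; there are [n] places for it. *)
Lemma pow_coef_top (v : nat -> R) (n k : nat) :
  pow_coef v n (S k)
  = INR n * v 0%nat ^ pred n * v (S k) + pow_coef (truncate k v) n (S k).
Proof.
  assert (E0 : truncate k v 0%nat = v 0%nat) by reflexivity.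
  assert (E1 : truncate k v (S k) = 0).
  { unfold truncate. now rewrite (proj2 (Nat.leb_gt (S k) k)) by lia. }
  assert (Ei : forall i, (i <= k)%nat -> v i = truncate k v i).
  { intros i Hi. unfold truncate. now rewrite (proj2 (Nat.leb_le i k)) by lia. }
  induction n as [|n IH]; [simpl; ring|]. simpl pow_coef.
  rewrite (PS_mult_ends v), (PS_mult_ends (truncate k v)).
  rewrite IH, E0, E1, !pow_coef_O.
  replace (PS_mult (drop_head v) (drop_head (pow_coef v n)) (S k))
    with (PS_mult (drop_head (truncate k v)) (drop_head (pow_coef (truncate k v) n)) (S k)).
  2:{ unfold PS_mult. apply sum_eq. intros i Hi. destruct i as [|i]; simpl drop_head; [ring|].
      replace (S k - S i)%nat with (k - i)%nat by lia.
      destruct (Nat.eq_dec i k) as [->|Hik].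
      { rewrite Nat.sub_diag. simpl. ring. }
      rewrite (Ei (S i)) by lia. f_equal.
      destruct (k - i)%nat as [|l] eqn:El; [reflexivity|]. simpl. symmetry.
      apply pow_coef_ext. intros j Hj. apply Ei. lia. }
  rewrite S_INR. simpl pred.
  destruct n as [|n]; [simpl; ring|]. simpl pred. simpl pow. ring.
Qed.

(** A bound in which only the entries up to [k] occur; it makes every series below
    converge without assuming anything about later entries. *)
Lemma pow_coef_le_sum (v : nat -> R) (n k : nat) :
  Rabs (pow_coef v n k) <= sum_f_R0 (fun i => Rabs (v i)) k ^ n.
Proof.
  revert k. induction n as [|n IH]; intros k; simpl.
  - destruct k; rewrite ?Rabs_R1, ?Rabs_R0; lra.
  - unfold PS_mult. eapply Rle_trans; [apply Rsum_abs|].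
    rewrite Rmult_comm, scal_sum. apply sum_Rle. intros i Hi. rewrite Rabs_mult.
    apply Rmult_le_compat_l; [apply Rabs_pos|].
    eapply Rle_trans; [apply IH|]. apply pow_incr. split.
    + apply cond_pos_sum. intros; apply Rabs_pos.
    + destruct i as [|i].
      * rewrite Nat.sub_0_r. apply Rle_refl.
      * rewrite (tech2 (fun i => Rabs (v i)) (k - S i) k) by lia.
        assert (0 <= sum_f_R0 (fun j => Rabs (v (S (k - S i) + j)%nat)) (k - S (k - S i))); [|lra].
        apply cond_pos_sum. intros; apply Rabs_pos.
Qed.

(** Separates the part of the Adomian polynomial that is linear in its newest
    argument, which the method treats implicitly. *)
Lemma adomian_top (k : nat) (v : nat -> R) :
  adomian (S k) f v
  = Derive f (v 0%nat) * v (S k) + adomian (S k) f (truncate k v).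
Proof.
  rewrite entire_Derive, Rmult_comm, <- Series_scal_l, !adomian_eq.
  rewrite (Series_ext _ (fun n => a n * (INR n * v 0%nat ^ pred n * v (S k)
      + pow_coef (truncate k v) n (S k)))).
  2:{ intros n. now rewrite <- pow_coef_top. }
  rewrite <- Series_plus.
  - apply Series_ext. intros n. ring.
  - apply (ex_series_scal (V := R_NormedModule) (v (S k))
             (fun n => a n * (INR n * v 0%nat ^ pred n))).
    apply ex_series_Rabs, ex_series_dominated with (2 := B_pow_ex (1 + Rabs (v 0%nat))).
    apply coef_mult_le. intros n. apply pow_derive_le.
  - apply ex_series_Rabs.
    apply ex_series_dominated with
      (2 := B_pow_ex (sum_f_R0 (fun i => Rabs (truncate k v i)) (S k))).
    apply coef_mult_le. intros n. apply pow_coef_le_sum.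
Qed.

(** Weights closed under convolution up to a factor [kappa].  With such weights
    every estimate on a Cauchy product keeps the shape of the data, and powers
    cost only a geometric factor [sigma ^ n], which [B] absorbs. *)
Context (W : nat -> R) (kappa M sigma : R).
Context (W_ge0 : forall j, 0 <= W j) (W_0 : W 0%nat = 1).
Context (kappa_ge1 : 1 <= kappa) (M_ge0 : 0 <= M).
Context (W_conv : forall j, PS_mult W W j <= kappa * W j).
Context (sigma_eq : sigma = kappa * (1 + M)).

Lemma PS_mult_weight (g h : nat -> R) (c d : R) (k : nat) :
  0 <= c -> 0 <= d ->
  (forall i, (i <= k)%nat -> Rabs (g i) <= c * W i) ->
  (forall i, (i <= k)%nat -> Rabs (h i) <= d * W i) ->
  Rabs (PS_mult g h k) <= kappa * c * d * W k.
Proof.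
  intros Hc Hd Hg Hh.
  eapply Rle_trans; [apply Rabs_PS_mult_le; [exact Hg | exact Hh]|].
  rewrite PS_mult_scal.
  assert (0 <= c * d) by now apply Rmult_le_pos.
  replace (kappa * c * d * W k) with (c * d * (kappa * W k)) by ring.
  now apply Rmult_le_compat_l.
Qed.

(** The factors with the newest index cancel out, so that bounds on the indices
    [1..k] already suffice for the coefficient [S k]. *)
Lemma PS_mult_inner_weight (g h : nat -> R) (c d : R) (k : nat) :
  0 <= c -> 0 <= d ->
  (forall i, (1 <= i <= k)%nat -> Rabs (g i) <= c * W i) ->
  (forall i, (1 <= i <= k)%nat -> Rabs (h i) <= d * W i) ->
  Rabs (PS_mult (drop_head g) (drop_head h) (S k)) <= kappa * c * d * W (S k).
Proof.
  intros Hc Hd Hg Hh.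
  assert (Hcut : forall p e i, 0 <= e ->
    (forall l, (1 <= l <= k)%nat -> Rabs (p l) <= e * W l) ->
    Rabs (truncate k (drop_head p) i) <= e * W i).
  { intros p e i He Hp. assert (HW := W_ge0 i). unfold truncate.
    destruct (Nat.leb_spec i k) as [Hi|Hi].
    - destruct i as [|i]; simpl; [rewrite Rabs_R0; now apply Rmult_le_pos|].
      apply Hp. lia.
    - rewrite Rabs_R0. now apply Rmult_le_pos. }
  replace (PS_mult (drop_head g) (drop_head h) (S k))
    with (PS_mult (truncate k (drop_head g)) (truncate k (drop_head h)) (S k)).
  - apply PS_mult_weight; auto.
  - apply sum_eq. intros i Hi. unfold truncate.
    destruct (Nat.leb_spec i k) as [H1|H1].
    + destruct (Nat.leb_spec (S k - i) k) as [H2|H2]; [reflexivity|].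
      replace i with 0%nat by lia. simpl. ring.
    + replace (S k - i)%nat with 0%nat by lia. simpl. ring.
Qed.

Lemma sigma_pow_pos (n : nat) : 0 < sigma ^ n.
Proof. apply pow_lt. rewrite sigma_eq. nra. Qed.

Lemma pow_coef_weight (v : nat -> R) (n k : nat) :
  (forall i, (i <= k)%nat -> Rabs (v i) <= M * W i) ->
  Rabs (pow_coef v n k) <= sigma ^ n * W k.
Proof.
  revert k. induction n as [|n IH]; intros k H; simpl.
  - destruct k as [|k]; rewrite ?Rabs_R1, ?Rabs_R0.
    + rewrite W_0. lra.
    + specialize (W_ge0 (S k)). lra.
  - eapply Rle_trans.
    + apply PS_mult_weight with (c := M) (d := sigma ^ n); auto.
      * apply Rlt_le, sigma_pow_pos.
      * intros i Hi. apply IH. intros l Hl. apply H. lia.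
    + apply Rmult_le_compat_r; [apply W_ge0|].
      apply Rmult_le_compat_r; [apply Rlt_le, sigma_pow_pos|]. rewrite sigma_eq. nra.
Qed.

(** The constant [eta] passes through all products: differences are propagated by
    [v v' - w w' = (v - w) v' + w (v' - w')], and [sigma] is large enough for both
    summands. *)
Lemma pow_coef_diff_weight (v w : nat -> R) (eta : R) (n k : nat) : 0 <= eta ->
  (forall i, (i <= k)%nat -> Rabs (v i) <= M * W i) ->
  (forall i, (i <= k)%nat -> Rabs (w i) <= M * W i) ->
  (forall i, (i <= k)%nat -> Rabs (v i - w i) <= eta * W i) ->
  Rabs (pow_coef v n k - pow_coef w n k) <= eta * sigma ^ n * W k.
Proof.
  intros He. revert k. induction n as [|n IH]; intros k Hv Hw Hd; simpl.
  - rewrite Rminus_diag, Rabs_R0. specialize (W_ge0 k). nra.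
  - replace (PS_mult v (pow_coef v n) k - PS_mult w (pow_coef w n) k)
      with (PS_mult (fun i => v i - w i) (pow_coef v n) k
            + PS_mult w (fun i => pow_coef v n i - pow_coef w n i) k).
    2:{ unfold PS_mult. rewrite <- minus_sum, <- plus_sum. apply sum_eq. intros i Hi. ring. }
    assert (Hs := sigma_pow_pos n).
    eapply Rle_trans; [apply Rabs_triang|].
    assert (H1 : Rabs (PS_mult (fun i => v i - w i) (pow_coef v n) k)
              <= kappa * eta * sigma ^ n * W k).
    { apply PS_mult_weight; auto; [lra|]. intros i Hi. apply pow_coef_weight.
      intros l Hl. apply Hv. lia. }
    assert (H2 : Rabs (PS_mult w (fun i => pow_coef v n i - pow_coef w n i) k)
              <= kappa * M * (eta * sigma ^ n) * W k).
    { apply PS_mult_weight; auto; [nra|]. intros i Hi. apply IH; intros l Hl;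
      [apply Hv | apply Hw | apply Hd]; lia. }
    replace (eta * (sigma * sigma ^ n) * W k)
      with (kappa * eta * sigma ^ n * W k + kappa * M * (eta * sigma ^ n) * W k); [lra|].
    rewrite sigma_eq. ring.
Qed.

Lemma pow_coef_head (x : R) (n k : nat) :
  pow_coef (fun i => match i with O => x | S _ => 0 end) n (S k) = 0.
Proof.
  induction n as [|n IH]; simpl; [reflexivity|].
  rewrite PS_mult_ends, IH.
  replace (PS_mult _ _ _) with 0; [ring|].
  symmetry. apply sum_eq_R0. intros [|i] _; simpl; ring.
Qed.

(** Comparison with the sequence that keeps only the entry 0, whose powers have no
    coefficient of positive index. *)
Lemma pow_coef_small (v : nat -> R) (delta : R) (n k : nat) : 0 <= delta ->
  (forall i, (i <= S k)%nat -> Rabs (v i) <= M * W i) ->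
  (forall i, (1 <= i <= S k)%nat -> Rabs (v i) <= delta * W i) ->
  Rabs (pow_coef v n (S k)) <= delta * sigma ^ n * W (S k).
Proof.
  intros Hd Hv Hs.
  rewrite <- (Rminus_0_r (pow_coef v n (S k))), <- (pow_coef_head (v 0%nat) n k).
  apply pow_coef_diff_weight; auto.
  - intros [|i] Hi; [now apply Hv|]. rewrite Rabs_R0. specialize (W_ge0 (S i)). nra.
  - intros [|i] Hi.
    + rewrite Rminus_diag, Rabs_R0. specialize (W_ge0 0%nat). nra.
    + rewrite Rminus_0_r. apply Hs. lia.
Qed.

(** Without the top entry, every monomial of index [S k] has at least two
    factors of positive index: hence the second power of [delta]. *)
Lemma pow_coef_quadratic (v : nat -> R) (delta : R) (n k : nat) : 0 <= delta ->
  (forall i, (i <= S k)%nat -> Rabs (v i) <= M * W i) ->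
  (forall i, (1 <= i <= S k)%nat -> Rabs (v i) <= delta * W i) ->
  v (S k) = 0 ->
  Rabs (pow_coef v n (S k)) <= delta ^ 2 * sigma ^ n * W (S k).
Proof.
  intros Hd Hv Hs H0. induction n as [|n IH]; simpl.
  - rewrite Rabs_R0. specialize (W_ge0 (S k)). nra.
  - rewrite PS_mult_ends, H0, Rmult_0_l, Rplus_0_r.
    assert (Hp := sigma_pow_pos n).
    eapply Rle_trans; [apply Rabs_triang|].
    assert (H1 : Rabs (v 0%nat * pow_coef v n (S k)) <= M * (delta ^ 2 * sigma ^ n * W (S k))).
    { rewrite Rabs_mult. apply Rmult_le_compat; try apply Rabs_pos; [|exact IH].
      rewrite <- (Rmult_1_r M), <- W_0. apply Hv. lia. }
    assert (H2 : Rabs (PS_mult (drop_head v) (drop_head (pow_coef v n)) (S k))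
              <= kappa * delta * (delta * sigma ^ n) * W (S k)).
    { apply PS_mult_weight; [exact Hd | nra | |].
      - intros [|i] Hi; simpl drop_head; [|apply Hs; lia].
        rewrite Rabs_R0. specialize (W_ge0 0%nat). nra.
      - intros [|i] Hi; simpl drop_head.
        + rewrite Rabs_R0. assert (0 <= delta * sigma ^ n) by nra.
          specialize (W_ge0 0%nat). nra.
        + apply pow_coef_small; auto; intros l Hl; [apply Hv | apply Hs]; lia. }
    assert (0 <= delta ^ 2 * sigma ^ n * W (S k)).
    { apply Rmult_le_pos; [|apply W_ge0]. apply Rmult_le_pos; [apply pow2_ge_0 | lra]. }
    replace (delta * (delta * 1) * (sigma * sigma ^ n) * W (S k))
      with (kappa * (delta ^ 2 * sigma ^ n * W (S k))
            + kappa * M * (delta ^ 2 * sigma ^ n * W (S k))).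
    2:{ rewrite sigma_eq. ring. }
    replace (kappa * delta * (delta * sigma ^ n) * W (S k))
      with (kappa * (delta ^ 2 * sigma ^ n * W (S k))) in H2 by ring.
    set (X := delta ^ 2 * sigma ^ n * W (S k)) in *.
    assert (1 * (M * X) <= kappa * (M * X)); [|lra].
    apply Rmult_le_compat_r; [now apply Rmult_le_pos | exact kappa_ge1].
Qed.

Notation K := (Series (fun n => B n * sigma ^ n)).

Lemma Series_coef_le (d : nat -> R) (c : R) :
  (forall n, Rabs (d n) <= c * sigma ^ n) ->
  Rabs (Series (fun n => a n * d n)) <= c * K.
Proof.
  intros H. rewrite <- Series_scal_l. apply Series_abs_le.
  - intros n. rewrite Rabs_mult.
    replace (c * (B n * sigma ^ n)) with (B n * (c * sigma ^ n)) by ring.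
    apply Rmult_le_compat; try apply Rabs_pos; [apply a_le_B | apply H].
  - apply (ex_series_scal (V := R_NormedModule) c), B_pow_ex.
Qed.

Lemma adomian_weight (v : nat -> R) (k : nat) :
  (forall i, (i <= k)%nat -> Rabs (v i) <= M * W i) ->
  Rabs (adomian k f v) <= K * W k.
Proof.
  intros H. rewrite adomian_eq, Rmult_comm. apply Series_coef_le.
  intros n. rewrite Rmult_comm. now apply pow_coef_weight.
Qed.

Lemma adomian_diff_weight (v w : nat -> R) (eta : R) (k : nat) : 0 <= eta ->
  (forall i, (i <= k)%nat -> Rabs (v i) <= M * W i) ->
  (forall i, (i <= k)%nat -> Rabs (w i) <= M * W i) ->
  (forall i, (i <= k)%nat -> Rabs (v i - w i) <= eta * W i) ->
  Rabs (adomian k f v - adomian k f w) <= eta * K * W k.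
Proof.
  intros He Hv Hw Hd. rewrite !adomian_eq.
  assert (Hex : forall v, ex_series (fun n => a n * pow_coef v n k)).
  { intros z. apply ex_series_Rabs, ex_series_dominated with
      (2 := B_pow_ex (sum_f_R0 (fun i => Rabs (z i)) k)).
    apply coef_mult_le. intros n. apply pow_coef_le_sum. }
  rewrite <- Series_minus by apply Hex.
  rewrite (Series_ext _ (fun n => a n * (pow_coef v n k - pow_coef w n k)))
    by (intros n; ring).
  replace (eta * K * W k) with (eta * W k * K) by ring.
  apply Series_coef_le. intros n.
  replace (eta * W k * sigma ^ n) with (eta * sigma ^ n * W k) by ring.
  now apply pow_coef_diff_weight.
Qed.

Lemma adomian_small (v : nat -> R) (delta : R) (k : nat) : 0 <= delta ->
  (forall i, (i <= S k)%nat -> Rabs (v i) <= M * W i) ->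
  (forall i, (1 <= i <= S k)%nat -> Rabs (v i) <= delta * W i) ->
  Rabs (adomian (S k) f v) <= delta * K * W (S k).
Proof.
  intros Hd Hv Hs. rewrite adomian_eq.
  replace (delta * K * W (S k)) with (delta * W (S k) * K) by ring.
  apply Series_coef_le. intros n.
  replace (delta * W (S k) * sigma ^ n) with (delta * sigma ^ n * W (S k)) by ring.
  now apply pow_coef_small.
Qed.

Lemma adomian_quadratic (v : nat -> R) (delta : R) (k : nat) : 0 <= delta ->
  (forall i, (i <= S k)%nat -> Rabs (v i) <= M * W i) ->
  (forall i, (1 <= i <= S k)%nat -> Rabs (v i) <= delta * W i) ->
  v (S k) = 0 ->
  Rabs (adomian (S k) f v) <= delta ^ 2 * K * W (S k).
Proof.
  intros Hd Hv Hs H0. rewrite adomian_eq.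
  replace (delta ^ 2 * K * W (S k)) with (delta ^ 2 * W (S k) * K) by ring.
  apply Series_coef_le. intros n.
  replace (delta ^ 2 * W (S k) * sigma ^ n) with (delta ^ 2 * sigma ^ n * W (S k)) by ring.
  now apply pow_coef_quadratic.
Qed.

End Entire.

(** * Continuity on a subset of the line *)

Lemma continuous_on_R (D : R -> Prop) (f : R -> R) :
  continuous_on D f <->
  forall x, D x -> forall eps, 0 < eps -> exists d, 0 < d /\
    forall y, D y -> Rabs (y - x) < d -> Rabs (f y - f x) < eps.
Proof.
  split; intros H x Dx.
  - intros eps Heps.
    destruct (proj1 (filterlim_R _ _ _) (H x Dx) eps Heps) as [d Hd].
    exists d. split; [apply cond_pos|]. intros y Dy Hy. now apply Hd.
  - apply filterlim_R; [apply within_filter, locally_filter|]. intros eps Heps.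
    destruct (H x Dx eps Heps) as [d [Hd0 Hd]].
    exists (mkposreal d Hd0). intros y Hy Dy. now apply Hd.
Qed.

Lemma continuous_on_ext_R (D : R -> Prop) (f h : R -> R) :
  (forall x, D x -> f x = h x) -> continuous_on D f -> continuous_on D h.
Proof.
  rewrite !continuous_on_R. intros E H x Dx eps Heps.
  destruct (H x Dx eps Heps) as [d [Hd0 Hd]]. exists d. split; [exact Hd0|].
  intros y Dy Hy. rewrite <- !E by assumption. now apply Hd.
Qed.

Lemma continuous_on_const (D : R -> Prop) (c : R) : continuous_on D (fun _ => c).
Proof. intros x Dx. apply filterlim_const. Qed.

Lemma continuous_on_id (D : R -> Prop) : continuous_on D (fun x => x).
Proof.
  intros x _ A. unfold filtermap, within. apply filter_imp. auto.
Qed.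

Lemma continuous_on_plus (D : R -> Prop) (f h : R -> R) :
  continuous_on D f -> continuous_on D h -> continuous_on D (fun x => f x + h x).
Proof.
  intros Hf Hh x Dx.
  eapply filterlim_comp_2; [apply Hf, Dx | apply Hh, Dx|].
  apply (filterlim_plus (V := R_NormedModule)).
Qed.

Lemma continuous_on_mult (D : R -> Prop) (f h : R -> R) :
  continuous_on D f -> continuous_on D h -> continuous_on D (fun x => f x * h x).
Proof.
  intros Hf Hh x Dx.
  eapply filterlim_comp_2; [apply Hf, Dx | apply Hh, Dx|].
  apply (filterlim_mult (K := R_AbsRing)).
Qed.

Lemma continuous_on_minus (D : R -> Prop) (f h : R -> R) :
  continuous_on D f -> continuous_on D h -> continuous_on D (fun x => f x - h x).
Proof.
  intros Hf Hh. apply continuous_on_ext_R with (fun x => f x + (-1) * h x).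
  - intros; ring.
  - apply continuous_on_plus; [exact Hf|].
    apply continuous_on_mult; [apply continuous_on_const | exact Hh].
Qed.

Lemma continuous_on_abs (D : R -> Prop) (f : R -> R) :
  continuous_on D f -> continuous_on D (fun x => Rabs (f x)).
Proof.
  rewrite !continuous_on_R. intros H x Dx eps Heps.
  destruct (H x Dx eps Heps) as [d [Hd0 Hd]]. exists d. split; [exact Hd0|].
  intros y Dy Hy. eapply Rle_lt_trans; [apply Rabs_triang_inv2 | now apply Hd].
Qed.

Lemma continuous_on_sum (D : R -> Prop) (f : nat -> R -> R) (k : nat) :
  (forall i, (i <= k)%nat -> continuous_on D (f i)) ->
  continuous_on D (fun x => sum_f_R0 (fun i => f i x) k).
Proof.
  induction k as [|k IH]; intros H; simpl.
  - now apply H.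
  - apply continuous_on_plus; [apply IH; intros; apply H; lia | now apply H].
Qed.

Lemma continuous_on_pow (D : R -> Prop) (f : R -> R) (n : nat) :
  continuous_on D f -> continuous_on D (fun x => f x ^ n).
Proof.
  intros H. induction n as [|n IH]; simpl;
    [apply continuous_on_const | now apply continuous_on_mult].
Qed.

Lemma continuous_on_pow_coef (D : R -> Prop) (v : nat -> R -> R) (n k : nat) :
  (forall i, (i <= k)%nat -> continuous_on D (v i)) ->
  continuous_on D (fun x => pow_coef (fun i => v i x) n k).
Proof.
  revert k. induction n as [|n IH]; intros k H; simpl.
  - apply continuous_on_const.
  - unfold PS_mult.
    apply (continuous_on_sum D (fun i x => v i x * pow_coef (fun i => v i x) n (k - i)%nat)).
    intros i Hi. apply continuous_on_mult; [apply H, Hi|].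
    apply IH. intros l Hl. apply H. lia.
Qed.

Lemma continuous_on_uniform_limit (D : R -> Prop) (f : nat -> R -> R) (l : R -> R) :
  (forall n, continuous_on D (f n)) ->
  (forall eps, 0 < eps -> exists n, forall x, D x -> Rabs (f n x - l x) < eps) ->
  continuous_on D l.
Proof.
  intros Hf Hl. apply continuous_on_R. intros x Dx eps Heps.
  destruct (Hl (eps / 3)) as [n Hn]; [lra|].
  destruct (proj1 (continuous_on_R _ _) (Hf n) x Dx (eps / 3)) as [d [Hd0 Hd]]; [lra|].
  exists d. split; [exact Hd0|]. intros y Dy Hy.
  assert (H1 := Hn x Dx). assert (H2 := Hn y Dy). assert (H3 := Hd y Dy Hy).
  apply Rabs_def2 in H1. apply Rabs_def2 in H2. apply Rabs_def2 in H3.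
  apply Rabs_def1; lra.
Qed.

(** Continuity of an entire series in [x] along continuous arguments, by the
    filter form of Tannery's theorem: near a point the argument [q] of the
    majorant is bounded. *)
Lemma continuous_on_entire (D : R -> Prop) (a : nat -> R -> R) (B : nat -> R)
    (d : nat -> R -> R) (q : R -> R) :
  (forall n, continuous_on D (a n)) ->
  (forall n x, D x -> Rabs (a n x) <= B n) ->
  (forall u, ex_pseries B u) ->
  (forall n, continuous_on D (d n)) ->
  continuous_on D q -> (forall x, D x -> 0 <= q x) ->
  (forall n x, D x -> Rabs (d n x) <= q x ^ n) ->
  continuous_on D (fun x => Series (fun n => a n x * d n x)).
Proof.
  intros Ha HB HE Hd Hq Hq0 Hdq x Dx.
  apply (tannery _ (fun x n => a n x * d n x) (fun n => a n x * d n x)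
           (fun n => B n * (q x + 1) ^ n)).
  - now apply B_pow_ex.
  - intros n. exact (continuous_on_mult D _ _ (Ha n) (Hd n) x Dx).
  - apply coef_mult_le; [now intros n; apply HB|]. intros n.
    eapply Rle_trans; [now apply Hdq|]. apply pow_incr. specialize (Hq0 x Dx). lra.
  - destruct (proj1 (continuous_on_R _ _) Hq x Dx 1) as [e [He0 He]]; [lra|].
    exists (mkposreal e He0). intros y Hy Dy.
    apply coef_mult_le; [now intros n; apply HB|]. intros n.
    eapply Rle_trans; [now apply Hdq|]. apply pow_incr. specialize (Hq0 y Dy).
    specialize (He y Dy Hy). apply Rabs_def2 in He. lra.
Qed.

(** * Comparison on a half-line *)

(** Freezing a function to the left of [x0] turns continuity on the half-line into
    continuity on the line, which the theorems on compact intervals and on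
    integrals require. *)
Lemma continuous_clamp (x0 : R) (f : R -> R) : continuous_on (ray x0) f ->
  forall x, continuous (fun y => f (Rmax x0 y)) x.
Proof.
  intros H x. apply filterlim_R; [apply locally_filter|]. intros eps Heps.
  destruct (proj1 (continuous_on_R _ _) H (Rmax x0 x) (Rmax_l x0 x) eps Heps)
    as [d [Hd0 Hd]].
  exists (mkposreal d Hd0). intros y Hy. apply Hd; [apply Rmax_l|].
  eapply Rle_lt_trans; [|exact Hy]. unfold minus, plus, opp, abs; simpl.
  unfold Rmax. destruct (Rle_dec x0 y), (Rle_dec x0 x);
    unfold Rabs; repeat destruct Rcase_abs; lra.
Qed.

Lemma continuous_on_max (x0 : R) (f : R -> R) (a b : R) :
  continuous_on (ray x0) f -> x0 <= a <= b ->
  exists y, a <= y <= b /\ forall x, a <= x <= b -> f x <= f y.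
Proof.
  intros H Hab.
  destruct (continuity_ab_maj (fun y => f (Rmax x0 y)) a b) as [y [H1 H2]]; [lra| |].
  - intros c _. now apply continuity_pt_filterlim, continuous_clamp.
  - exists y. split; [exact H2|]. intros x Hx. specialize (H1 x Hx). cbv beta in H1.
    rewrite !Rmax_right in H1 by lra. exact H1.
Qed.

(** A positive maximum of [f] would have larger values to its left.  Every
    differential inequality below is an instance; as only left neighbourhoods
    occur, the grid points need no separate treatment. *)
Lemma barrier (x0 : R) (f : R -> R) (a b : R) :
  continuous_on (ray x0) f -> x0 <= a -> f a <= 0 ->
  (forall y, a < y <= b -> 0 < f y -> exists z, a <= z < y /\ f y < f z) ->
  forall x, a <= x <= b -> f x <= 0.
Proof.
  intros Hf Ha H0 Hb x Hx.
  destruct (continuous_on_max x0 f a b Hf) as [y [Hy Hmax]]; [lra|].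
  destruct (Rle_lt_dec (f x) 0) as [|Hpos]; [assumption|exfalso].
  assert (Hfy := Hmax x Hx).
  assert (y <> a) by (intros ->; lra).
  destruct (Hb y) as [z [Hz Hlt]]; try lra.
  specialize (Hmax z). lra.
Qed.

Lemma D_in_neg_left (f d : R -> R) (D : R -> Prop) (s x : R) :
  D_in f d D x -> (forall z, s <= z < x -> D z) -> s < x -> d x < 0 ->
  exists z, s <= z < x /\ f x < f z.
Proof.
  intros H HD Hs Hd. destruct (H (- d x)) as [e [He0 He]]; [lra|].
  pose (z := Rmax s (x - e / 2)).
  assert (Hz : s <= z < x /\ x - z < e).
  { unfold z, Rmax. destruct Rle_dec; lra. }
  exists z. split; [apply Hz|].
  assert (Hq : Rabs ((f z - f x) / (z - x) - d x) < - d x).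
  { apply He. split; [split; [apply HD; lra | lra]|].
    simpl. unfold Rdist. rewrite Rabs_left; lra. }
  apply Rabs_def2 in Hq. destruct Hq as [Hq _].
  assert (E : f x - f z = (f z - f x) / (z - x) * (x - z)) by (field; lra).
  assert ((f z - f x) / (z - x) < 0) by lra. nra.
Qed.

(** The derivative at [y] within some set that contains an interval to the left of
    [y].  One notion then covers the half-line and the cells of a grid, and does not
    distinguish grid points from the others. *)
Definition left_slope (f : R -> R) (s y l : R) : Prop :=
  exists D d r, s <= r < y /\ (forall z, r <= z < y -> D z) /\
    D_in f d D y /\ d y = l.

Lemma left_slope_neg (f : R -> R) (s y l : R) :
  left_slope f s y l -> l < 0 -> exists z, s <= z < y /\ f y < f z.
Proof.
  intros (D & d & r & Hr & HD & Hf & Hl) Hneg.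
  destruct (D_in_neg_left f d D r y Hf HD) as [z [Hz Hlt]]; [lra | lra|].
  exists z. split; [lra | exact Hlt].
Qed.

Lemma left_slope_affine (f : R -> R) (s y l c p q : R) :
  left_slope f s y l -> left_slope (fun z => c * f z - (p + q * z)) s y (c * l - q).
Proof.
  intros (D & d & r & Hr & HD & Hf & Hl).
  exists D, (fun z => c * d z - (0 + q * 1)), r. repeat split; try (apply Hr || apply HD).
  - apply Dminus; [now apply Dmult_const|]. apply Dadd; [apply Dconst|].
    apply (Dmult_const D (fun z => z) (fun _ => 1)), Dx.
  - rewrite Hl. ring.
Qed.

(** The slope [L] is first exceeded by a small [e], which makes the inequality
    required by [barrier] strict. *)
Lemma mean_value_le (x0 : R) (f : R -> R) (s b L : R) :
  continuous_on (ray x0) f -> x0 <= s ->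
  (forall y, s < y <= b -> exists l, left_slope f s y l /\ l <= L) ->
  forall x, s <= x <= b -> f x - f s <= L * (x - s).
Proof.
  intros Hf Hs HL x Hx. apply Rnot_lt_le. intros Hlt.
  (* With this [e] the line of slope [L + e] would still pass below [f x]. *)
  pose (e := (f x - f s - L * (x - s)) / (1 + (x - s))).
  assert (He : 0 < e) by (apply Rdiv_lt_0_compat; lra).
  assert (Hb : 1 * f x - (f s - (L + e) * s + (L + e) * x) <= 0).
  { apply (barrier x0 (fun y => 1 * f y - (f s - (L + e) * s + (L + e) * y)) s b); auto.
    - apply continuous_on_minus.
      + apply continuous_on_mult; [apply continuous_on_const | exact Hf].
      + apply continuous_on_plus; [apply continuous_on_const|].
        apply continuous_on_mult; [apply continuous_on_const | apply continuous_on_id].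
    - lra.
    - intros y Hy _. destruct (HL y Hy) as [l [Hl HlL]].
      apply (left_slope_neg (fun y => 1 * f y - (f s - (L + e) * s + (L + e) * y))
               s y (1 * l - (L + e))); [|lra].
      now apply left_slope_affine. }
  assert (E : e * (1 + (x - s)) = f x - f s - L * (x - s)) by (unfold e; field; lra).
  lra.
Qed.

Lemma mean_value_abs (x0 : R) (f : R -> R) (s b L : R) :
  continuous_on (ray x0) f -> x0 <= s ->
  (forall y, s < y <= b -> exists l, left_slope f s y l /\ Rabs l <= L) ->
  forall x, s <= x <= b -> Rabs (f x - f s) <= L * (x - s).
Proof.
  intros Hf Hs HL x Hx. apply Rabs_le. split.
  - assert (H : -1 * f x - (0 + 0 * x) - (-1 * f s - (0 + 0 * s)) <= L * (x - s)); [|lra].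
    apply (mean_value_le x0 (fun z => -1 * f z - (0 + 0 * z)) s b); auto.
    + apply continuous_on_minus.
      * apply continuous_on_mult; [apply continuous_on_const | exact Hf].
      * apply continuous_on_plus; [apply continuous_on_const|].
        apply continuous_on_mult; [apply continuous_on_const | apply continuous_on_id].
    + intros y Hy. destruct (HL y Hy) as [l [Hl HlL]]. apply Rabs_le_between in HlL.
      exists (-1 * l - 0). split; [now apply left_slope_affine | lra].
  - apply (mean_value_le x0 f s b); auto.
    intros y Hy. destruct (HL y Hy) as [l [Hl HlL]]. apply Rabs_le_between in HlL.
    exists l. split; [exact Hl | lra].
Qed.

Lemma D_in_continuous_on (D : R -> Prop) (f d : R -> R) :
  derivative_on D f d -> continuous_on D f.
Proof.
  intros H. apply continuous_on_R. intros x Dx eps Heps.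
  destruct (cont_deriv f d D x (H x Dx) eps Heps) as [e [He0 He]].
  exists e. split; [exact He0|]. intros y Dy Hy.
  destruct (Req_dec y x) as [->|Hne].
  - now rewrite Rminus_diag, Rabs_R0.
  - apply He. split; [split; auto | exact Hy].
Qed.

Lemma is_derive_D_in (D : R -> Prop) (f d : R -> R) (x : R) :
  is_derive f x (d x) -> D_in f d D x.
Proof.
  intros H. apply D_in_imp with no_cond; [intros; exact I|].
  now apply derivable_pt_lim_D_in, is_derive_Reals.
Qed.

Lemma antiderivative (x0 : R) (f : R -> R) : continuous_on (ray x0) f ->
  exists F : R -> R, forall x, is_derive F x (f (Rmax x0 x)).
Proof.
  intros H. exists (RInt (fun y => f (Rmax x0 y)) 0). intros x.
  apply (is_derive_RInt (V := R_NormedModule) (fun y => f (Rmax x0 y)) _ 0).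
  - apply filter_forall. intros y. apply (RInt_correct (V := R_CompleteNormedModule)).
    apply (ex_RInt_continuous (V := R_CompleteNormedModule)).
    intros z _. now apply continuous_clamp.
  - now apply continuous_clamp.
Qed.

(** Variation of constants. *)
Lemma linear_ode (x0 : R) (p q : R -> R) (s c : R) :
  continuous_on (ray x0) p -> continuous_on (ray x0) q ->
  exists v, v s = c /\ forall D x, ray x0 x -> D_in v (fun x => p x * v x + q x) D x.
Proof.
  intros Hp Hq. destruct (antiderivative x0 p Hp) as [P HP].
  assert (HPc : continuous_on (ray x0) P).
  { intros x _ A HA.
    assert (Hc : continuous P x).
    { apply (ex_derive_continuous (V := R_NormedModule)). eexists. apply HP. }
    specialize (Hc A HA). unfold filtermap, within in *. revert Hc.
    apply filter_imp. auto. }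
  destruct (antiderivative x0 (fun x => exp (- P x) * q x)) as [Q HQ].
  { apply continuous_on_mult; [|exact Hq]. intros x Dx.
    apply filterlim_comp with (locally (- P x)).
    - apply filterlim_comp with (locally (P x)); [now apply HPc|].
      apply (filterlim_opp (V := R_NormedModule)).
    - apply continuous_exp. }
  exists (fun x => exp (P x) * (c * exp (- P s) + (Q x - Q s))). split.
  - rewrite Rminus_diag, Rplus_0_r. rewrite (Rmult_comm c), <- Rmult_assoc, <- exp_plus.
    rewrite Rplus_opp_r, exp_0. ring.
  - intros D x Hx. apply is_derive_D_in.
    assert (H1 := HP x). assert (H2 := HQ x).
    cbv beta in H2. rewrite Rmax_right in H1, H2 by exact Hx.
    auto_derive.
    + split; [eexists; exact H1 | split; [eexists; exact H2 | exact I]].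
    + replace (Derive (fun y : R => P y) x) with (p x)
        by (symmetry; now apply is_derive_unique).
      replace (Derive (fun y : R => Q y) x) with (exp (- P x) * q x)
        by (symmetry; now apply is_derive_unique).
      rewrite (exp_Ropp (P x)). field. apply Rgt_not_eq, exp_pos.
Qed.

(** * Grids *)

Lemma grid_ge (x0 : R) (g : nat -> R) (i : nat) : is_grid x0 g -> x0 <= g i.
Proof.
  intros [H0 [Hlt _]]. induction i as [|i IH]; [lra|]. specialize (Hlt i). lra.
Qed.

Lemma grid_le (x0 : R) (g : nat -> R) (i j : nat) :
  is_grid x0 g -> (i <= j)%nat -> g i <= g j.
Proof.
  intros [_ [Hlt _]] Hij. induction Hij as [|j Hij IH]; [lra|]. specialize (Hlt j). lra.
Qed.

Lemma cell_ray (x0 : R) (g : nat -> R) (i : nat) (x : R) :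
  is_grid x0 g -> cell g i x -> ray x0 x.
Proof.
  intros Hg [H _]. unfold ray. assert (H1 := grid_ge x0 g i Hg). lra.
Qed.

Lemma grid_unbounded (x0 : R) (g : nat -> R) (x : R) :
  is_grid x0 g -> exists n, x < g n.
Proof.
  intros [_ [_ Hlim]]. apply is_lim_seq_spec in Hlim. destruct (Hlim x) as [n Hn].
  exists n. now apply Hn.
Qed.

Lemma grid_cell_right_open (x0 : R) (g : nat -> R) (x : R) :
  is_grid x0 g -> ray x0 x -> exists i, g i <= x < g (S i).
Proof.
  intros Hg Hx. destruct (grid_unbounded x0 g x Hg) as [n Hn].
  induction n as [|n IH].
  - destruct Hg as [H0 _]. unfold ray in Hx. lra.
  - destruct (Rlt_le_dec x (g n)) as [H|H]; [now apply IH|]. exists n. lra.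
Qed.

Lemma grid_cell_left_open (x0 : R) (g : nat -> R) (x : R) :
  is_grid x0 g -> x0 < x -> exists i, g i < x <= g (S i).
Proof.
  intros Hg Hx. destruct (grid_unbounded x0 g x Hg) as [n Hn].
  induction n as [|n IH].
  - destruct Hg as [H0 _]. lra.
  - destruct (Rlt_le_dec x (g n)) as [H|H]; [now apply IH|].
    destruct (Req_dec (g n) x) as [E|E].
    + destruct n as [|n]; [destruct Hg as [H0 _]; lra|].
      exists n. assert (H1 := proj1 (proj2 Hg) n). lra.
    + exists n. lra.
Qed.

Lemma grid_index_unique (x0 : R) (g : nat -> R) (i j : nat) (x : R) :
  is_grid x0 g -> g i <= x < g (S i) -> cell g j x ->
  j = i \/ (i = S j /\ x = g i).
Proof.
  intros Hg Hi [Hj1 Hj2].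
  destruct (Compare_dec.lt_eq_lt_dec i j) as [[H|H]|H].
  - assert (H1 := grid_le x0 g (S i) j Hg H). lra.
  - now left.
  - assert (H1 := grid_le x0 g (S j) i Hg H). right.
    assert (x = g i) by lra. split; [|assumption].
    destruct (Nat.eq_dec i (S j)) as [|Hne]; [assumption|exfalso].
    assert (H2 := proj1 (proj2 Hg) (S j)).
    assert (H3 := grid_le x0 g (S (S j)) i Hg).
    assert (g (S (S j)) <= g i) by (apply H3; lia). lra.
Qed.

Lemma continuous_on_cells (x0 : R) (g : nat -> R) (f : R -> R) :
  is_grid x0 g -> (forall i, continuous_on (cell g i) f) -> continuous_on (ray x0) f.
Proof.
  intros Hg Hf. apply continuous_on_R. intros x Hx eps Heps.
  destruct (grid_cell_right_open x0 g x Hg Hx) as [i Hi].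
  destruct (proj1 (continuous_on_R _ _) (Hf i) x) with (eps := eps)
    as [d [Hd0 Hd]]; [split; lra | exact Heps|].
  assert (Hleft : exists e, 0 < e /\ forall y, ray x0 y -> y < g i -> Rabs (y - x) < e ->
     Rabs (f y - f x) < eps).
  { destruct i as [|i].
    - exists 1. split; [lra|]. intros y Hy Hlt. destruct Hg as [H0 _]. unfold ray in Hy. lra.
    - destruct (Req_dec (g (S i)) x) as [E|E].
      + assert (Hlt := proj1 (proj2 Hg) i).
        destruct (proj1 (continuous_on_R _ _) (Hf i) x) with (eps := eps)
          as [e [He0 He]]; [split; lra | exact Heps|].
        exists (Rmin e (g (S i) - g i)). split; [apply Rmin_glb_lt; lra|].
        intros y Hy Hyl Hd'. apply He.
        * assert (H1 := Rmin_r e (g (S i) - g i)). apply Rabs_def2 in Hd'. split; lra.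
        * eapply Rlt_le_trans; [exact Hd' | apply Rmin_l].
      + exists (x - g (S i)). split; [lra|]. intros y _ Hyl Hd'.
        apply Rabs_def2 in Hd'. lra. }
  destruct Hleft as [e [He0 He]].
  exists (Rmin (Rmin d e) (g (S i) - x)). split.
  { apply Rmin_glb_lt; [apply Rmin_glb_lt|]; lra. }
  intros y Hy Hyx.
  assert (H1 := Rmin_l (Rmin d e) (g (S i) - x)).
  assert (H2 := Rmin_r (Rmin d e) (g (S i) - x)).
  assert (H3 := Rmin_l d e). assert (H4 := Rmin_r d e).
  destruct (Rlt_le_dec y (g i)) as [Hyl|Hyl].
  - apply He; auto. lra.
  - apply Hd; [|lra]. assert (H5 := Hyx). apply Rabs_def2 in H5. split; lra.
Qed.

(** The cells are treated in order, each solution starting from the value that the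
    previous one has reached.  The pieces differ outside their cells, so [P i] must
    depend only on the values on the cell [i]. *)
Lemma glue_cells (x0 : R) (g : nat -> R) (P : nat -> (R -> R) -> Prop) (c0 : R) :
  is_grid x0 g ->
  (forall i f h, (forall x, cell g i x -> f x = h x) -> P i f -> P i h) ->
  (forall i c, exists f, f (g i) = c /\ P i f) ->
  exists v, v x0 = c0 /\ forall i, P i v.
Proof.
  intros Hg Hext Hsol.
  pose (sol := fun i c => proj1_sig (constructive_indefinite_description _ (Hsol i c))).
  assert (Hs : forall i c, sol i c (g i) = c /\ P i (sol i c)).
  { intros i c. exact (proj2_sig (constructive_indefinite_description _ (Hsol i c))). }
  pose (start := fix start (i : nat) : R :=
    match i with O => c0 | S i => sol i (start i) (g (S i)) end).
  assert (Hidx : forall x, exists i, ray x0 x -> g i <= x < g (S i)).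
  { intros x. destruct (Rle_lt_dec x0 x) as [H|H].
    - destruct (grid_cell_right_open x0 g x Hg H) as [i Hi]. now exists i.
    - exists 0%nat. unfold ray. lra. }
  pose (idx := fun x => proj1_sig (constructive_indefinite_description _ (Hidx x))).
  assert (Hi : forall x, ray x0 x -> g (idx x) <= x < g (S (idx x))).
  { intros x. exact (proj2_sig (constructive_indefinite_description _ (Hidx x))). }
  pose (v := fun x => sol (idx x) (start (idx x)) x).
  assert (Hv : forall i x, cell g i x -> sol i (start i) x = v x).
  { intros i x Hx. unfold v.
    destruct (grid_index_unique x0 g (idx x) i x Hg) as [E|[E Ex]]; auto.
    - apply Hi, (cell_ray x0 g i x Hg Hx).
    - now rewrite E.
    - rewrite E in Ex |- *. rewrite Ex, (proj1 (Hs _ _)). reflexivity. }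
  exists v. split.
  - assert (H0 := proj1 Hg).
    rewrite <- (Hv 0%nat).
    + rewrite <- H0. apply Hs.
    + assert (Hlt := proj1 (proj2 Hg) 0%nat). split; lra.
  - intros i. apply Hext with (1 := Hv i). apply Hs.
Qed.

Lemma derivative_on_ext (D : R -> Prop) (f h d e : R -> R) :
  (forall x, D x -> f x = h x) -> (forall x, D x -> d x = e x) ->
  derivative_on D f d -> derivative_on D h e.
Proof.
  intros Ef Ed H x Dx eps Heps. destruct (H x Dx eps Heps) as [r [Hr0 Hr]].
  exists r. split; [exact Hr0|]. intros y [[Dy Hne] Hy].
  rewrite <- !Ef, <- Ed by assumption. apply Hr. split; [split; assumption | exact Hy].
Qed.

Lemma max_step_ge (g : nat -> R) (h : R) (i : nat) :
  Rbar_le (max_step g) h -> g (S i) - g i <= h.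
Proof.
  intros H.
  destruct (is_sup_seq_lub _ _ (Sup_seq_correct (fun i => Finite (g (S i) - g i))))
    as [Hub _].
  assert (Hs := Hub (Finite (g (S i) - g i)) (ex_intro _ i eq_refl)).
  exact (Rbar_le_trans _ _ _ Hs H).
Qed.

(** * Existence of the terms *)

(** The right-hand side of the problem for the term [j], without [phi], once the
    unknown is put back into the Adomian polynomials. *)
Definition FD_rhs (N : R -> R -> R) (u : nat -> R -> R) (j : nat) (s x : R) : R :=
  PS_mult (fun i => u i x) (fun q => adomian q (N x) (fun i => u i s)) j
  + match j with
    | O => 0
    | S j => PS_mult (fun i => u i x)
               (fun q => adomian q (N x) (fun i => u i x)
                         - adomian q (N x) (fun i => u i s)) j
    end.

Definition first_only (c : R) (j : nat) : R := match j with O => c | S _ => 0 end.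

Lemma FD_F_eq (N : R -> R -> R) (u : nat -> R -> R) (j : nat) (s x : R) :
  FD_F N u j s x
  = PS_mult (drop_head (fun i => u i x))
      (drop_head (fun q => adomian q (N x) (fun i => u i s))) (S j)
    + PS_mult (fun i => u i x)
        (fun q => adomian q (N x) (fun i => u i x)
                  - adomian q (N x) (fun i => u i s)) j
    + adomian (S j) (N x) (truncate j (fun i => u i s)) * u 0%nat x.
Proof.
  unfold FD_F. f_equal. f_equal.
  - unfold PS_mult. rewrite <- sum_n_Reals, sum_Sn. unfold sum_n.
    rewrite (sum_Sn_m _ 0 j) by lia.
    rewrite Nat.sub_diag. simpl (drop_head _ 0).
    rewrite Rmult_0_l, Rmult_0_r. change plus with Rplus. rewrite Rplus_0_r, Rplus_0_l.
    apply sum_n_m_ext_loc. intros p Hp. destruct p as [|p]; [lia|].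
    replace (S j - S p)%nat with (S (j - S p)) by lia. simpl drop_head. apply Rmult_comm.
  - unfold PS_mult. rewrite sum_n_Reals. apply sum_eq. intros i Hi. apply Rmult_comm.
Qed.

Lemma FD_F_ext (N : R -> R -> R) (u w : nat -> R -> R) (j : nat) (s x : R) :
  (forall i y, (i <= j)%nat -> u i y = w i y) -> FD_F N u j s x = FD_F N w j s x.
Proof.
  intros H. unfold FD_F. f_equal; [f_equal|].
  - apply sum_n_m_ext_loc. intros p Hp. f_equal; [|apply H; lia].
    apply adomian_ext. intros i Hi. apply H. lia.
  - apply sum_n_ext_loc. intros p Hp. f_equal; [|apply H; lia].
    f_equal; apply adomian_ext; intros i Hi; apply H; lia.
  - f_equal; [|apply H; lia]. apply adomian_ext. intros i Hi.
    destruct (Nat.leb_spec i j); [now apply H | reflexivity].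
Qed.

Section Problem.

Context (x0 : R) (N : R -> R -> R) (phi : R -> R) (a : nat -> R -> R) (B : nat -> R).
Context (a_cont : forall i, continuous_on (ray x0) (a i)).
Context (a_le_B : forall i x, ray x0 x -> Rabs (a i x) <= B i).
Context (B_entire : forall u, ex_pseries B u).
Context (N_series : forall x u, ray x0 x -> is_pseries (fun i => a i x) u (N x u)).
Context (phi_cont : continuous_on (ray x0) phi).

Lemma continuous_on_N (u : R -> R) : continuous_on (ray x0) u ->
  continuous_on (ray x0) (fun x => N x (u x)).
Proof.
  intros Hu. apply continuous_on_ext_R with (fun x => Series (fun n => a n x * u x ^ n)).
  - intros x Hx. apply is_series_unique, is_pseries_R, N_series, Hx.
  - apply continuous_on_entire with (B := B) (q := fun x => Rabs (u x)); auto.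
    + intros n. now apply continuous_on_pow.
    + now apply continuous_on_abs.
    + intros; apply Rabs_pos.
    + intros n x _. rewrite RPow_abs. apply Rle_refl.
Qed.

Lemma continuous_on_Derive_N (c : R) :
  continuous_on (ray x0) (fun x => Derive (N x) c).
Proof.
  apply continuous_on_ext_R with (fun x => Series (fun n => a n x * (INR n * c ^ pred n))).
  - intros x Hx. symmetry. apply entire_Derive with B; auto.
  - apply continuous_on_entire with (B := B) (q := fun x => 1 + Rabs c); auto.
    + intros; apply continuous_on_const.
    + apply continuous_on_const.
    + intros. assert (H1 := Rabs_pos c). lra.
    + intros. apply pow_derive_le.
Qed.

Lemma continuous_on_adomian (v : nat -> R -> R) (k : nat) :
  (forall i, (i <= k)%nat -> continuous_on (ray x0) (v i)) ->
  continuous_on (ray x0) (fun x => adomian k (N x) (fun i => v i x)).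
Proof.
  intros Hv.
  apply continuous_on_ext_R with
    (fun x => Series (fun n => a n x * pow_coef (fun i => v i x) n k)).
  - intros x Hx. symmetry. apply adomian_eq with B; auto.
  - apply continuous_on_entire with (B := B)
      (q := fun x => sum_f_R0 (fun i => Rabs (v i x)) k); auto.
    + intros n. now apply continuous_on_pow_coef.
    + apply continuous_on_sum. intros i Hi. now apply continuous_on_abs, Hv.
    + intros. apply cond_pos_sum. intros; apply Rabs_pos.
    + intros. apply pow_coef_le_sum.
Qed.

Lemma continuous_on_FD_F (u : nat -> R -> R) (j : nat) (s : R) :
  (forall i, (i <= j)%nat -> continuous_on (ray x0) (u i)) ->
  continuous_on (ray x0) (FD_F N u j s).
Proof.
  intros Hu.
  assert (Hs : forall q (w : nat -> R),
    continuous_on (ray x0) (fun x => adomian q (N x) w)).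
  { intros q w. apply (continuous_on_adomian (fun i _ => w i)).
    intros; apply continuous_on_const. }
  eapply continuous_on_ext_R; [intros x Hx; symmetry; apply FD_F_eq|].
  apply continuous_on_plus; [apply continuous_on_plus|].
  - unfold PS_mult. apply (continuous_on_sum (ray x0) (fun p x =>
      drop_head (fun i => u i x) p
      * drop_head (fun q => adomian q (N x) (fun i => u i s)) (S j - p))).
    intros [|p] Hp.
    + simpl (drop_head _ 0). apply continuous_on_ext_R with (fun _ => 0);
        [intros; ring | apply continuous_on_const].
    + simpl (drop_head _ (S p)). destruct (S j - S p)%nat eqn:E; simpl (drop_head _ _).
      * apply continuous_on_ext_R with (fun _ => 0);
          [intros; ring | apply continuous_on_const].
      * apply continuous_on_mult; [apply Hu; lia | apply Hs].
  - unfold PS_mult. apply (continuous_on_sum (ray x0) (fun p x =>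
      u p x * (adomian (j - p) (N x) (fun i => u i x)
               - adomian (j - p) (N x) (fun i => u i s)))).
    intros p Hp. apply continuous_on_mult; [now apply Hu|].
    apply continuous_on_minus; [|apply Hs].
    apply continuous_on_adomian. intros i Hi. apply Hu. lia.
  - apply continuous_on_mult; [apply Hs | apply Hu; lia].
Qed.

(** The implicit linear part and [FD_F] recombine into complete Cauchy products:
    the right-hand sides are the coefficients of [A(s)U(x) + t(A(x)-A(s))U(x)],
    where [U] and [A] generate the terms and their Adomian polynomials. *)
Lemma FD_rhs_S (u : nat -> R -> R) (j : nat) (s x : R) : ray x0 x ->
  N x (u 0%nat s) * u (S j) x
  + (Derive (N x) (u 0%nat s) * u 0%nat x * u (S j) s + FD_F N u j s x)
  = FD_rhs N u (S j) s x.
Proof.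
  intros Hx. unfold FD_rhs. rewrite FD_F_eq.
  rewrite (PS_mult_ends (fun i => u i x) (fun q => adomian q (N x) (fun i => u i s))).
  rewrite adomian_O.
  rewrite (adomian_top (fun n => a n x) B (N x)) with (v := fun i => u i s); auto. ring.
Qed.

Lemma FD_terms_rhs (u0 : R) (g : nat -> R) (u : nat -> R -> R) :
  is_grid x0 g -> FD_terms N phi x0 u0 g u ->
  forall j i, derivative_on (cell g i) (u j)
    (fun x => FD_rhs N u j (g i) x + first_only (phi x) j).
Proof.
  intros Hg [_ [_ [H0 [_ HS]]]] [|j] i.
  - apply derivative_on_ext with (3 := H0 i); [reflexivity|].
    intros x Hx. unfold FD_rhs, PS_mult. simpl. rewrite adomian_O. ring.
  - apply derivative_on_ext with (3 := HS j i); [reflexivity|].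
    intros x Hx. rewrite FD_rhs_S by exact (cell_ray x0 g i x Hg Hx). simpl. ring.
Qed.

Section Grid.

Context (g : nat -> R) (g_grid : is_grid x0 g).

(** The coefficients may depend on the value of the unknown at the left end of the
    cell: on each cell this is a constant, so the problem there is a linear equation. *)
Lemma linear_cells (P Q : R -> nat -> R -> R) (c0 : R) :
  (forall c i, continuous_on (ray x0) (P c i)) ->
  (forall c i, continuous_on (ray x0) (Q c i)) ->
  exists w, w x0 = c0 /\ continuous_on (ray x0) w /\
    forall i, derivative_on (cell g i) w
      (fun x => P (w (g i)) i x * w x + Q (w (g i)) i x).
Proof.
  intros HP HQ.
  destruct (glue_cells x0 g (fun i w => derivative_on (cell g i) w
      (fun x => P (w (g i)) i x * w x + Q (w (g i)) i x)) c0 g_grid) as [w [Hw0 Hw]].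
  - intros i f h E H. apply derivative_on_ext with (3 := H); [exact E|].
    intros x Hx. rewrite (E x Hx), (E (g i)); [reflexivity|].
    assert (Hlt := proj1 (proj2 g_grid) i). split; lra.
  - intros i c.
    destruct (linear_ode x0 (P c i) (Q c i) (g i) c (HP c i) (HQ c i)) as [f [Hf0 Hf]].
    exists f. split; [exact Hf0|]. rewrite Hf0. intros x Hx.
    apply Hf. exact (cell_ray x0 g i x g_grid Hx).
  - exists w. split; [exact Hw0|]. split; [|exact Hw].
    apply continuous_on_cells with g; [exact g_grid|]. intros i.
    exact (D_in_continuous_on _ _ _ (Hw i)).
Qed.

Lemma FD_first_exists (u0 : R) : exists w, w x0 = u0 /\ continuous_on (ray x0) w /\
  forall i, derivative_on (cell g i) w (fun x => N x (w (g i)) * w x + phi x).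
Proof.
  apply (linear_cells (fun c _ x => N x c) (fun _ _ => phi)); [|auto].
  intros c _. apply (continuous_on_N (fun _ => c)), continuous_on_const.
Qed.

Lemma FD_next_exists (u : nat -> R -> R) (j : nat) :
  (forall i, (i <= j)%nat -> continuous_on (ray x0) (u i)) ->
  exists w, w x0 = 0 /\ continuous_on (ray x0) w /\
  forall i, derivative_on (cell g i) w
     (fun x => N x (u 0%nat (g i)) * w x
               + (Derive (N x) (u 0%nat (g i)) * u 0%nat x * w (g i)
                  + FD_F N u j (g i) x)).
Proof.
  intros Hu.
  apply (linear_cells (fun _ i x => N x (u 0%nat (g i)))
    (fun c i x => Derive (N x) (u 0%nat (g i)) * u 0%nat x * c + FD_F N u j (g i) x)).
  - intros _ i. apply (continuous_on_N (fun _ => u 0%nat (g i))), continuous_on_const.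
  - intros c i. apply continuous_on_plus; [|now apply continuous_on_FD_F].
    apply continuous_on_mult; [|apply continuous_on_const].
    apply continuous_on_mult; [apply continuous_on_Derive_N | apply Hu; lia].
Qed.

Lemma FD_exists (u0 : R) : exists v, FD_terms N phi x0 u0 g v.
Proof.
  destruct (FD_first_exists u0) as [w0 [Hw0 [Hw0c Hw0d]]].
  assert (Hnext : forall j u, exists w,
    (forall i, (i <= j)%nat -> continuous_on (ray x0) (u i)) ->
    w x0 = 0 /\ continuous_on (ray x0) w /\
    forall i, derivative_on (cell g i) w
     (fun x => N x (u 0%nat (g i)) * w x
               + (Derive (N x) (u 0%nat (g i)) * u 0%nat x * w (g i)
                  + FD_F N u j (g i) x))).
  { intros j u.
    destruct (classic
      (forall i, (i <= j)%nat -> continuous_on (ray x0) (u i))) as [H|H].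
    - destruct (FD_next_exists u j H) as [w Hw]. now exists w.
    - exists (fun _ => 0). contradiction. }
  pose (next := fun j u => proj1_sig (constructive_indefinite_description _ (Hnext j u))).
  assert (Hn := fun j u => proj2_sig (constructive_indefinite_description _ (Hnext j u))).
  change (forall j u, (forall i, (i <= j)%nat -> continuous_on (ray x0) (u i)) ->
    next j u x0 = 0 /\ continuous_on (ray x0) (next j u) /\
    forall i, derivative_on (cell g i) (next j u)
     (fun x => N x (u 0%nat (g i)) * next j u x
               + (Derive (N x) (u 0%nat (g i)) * u 0%nat x * next j u (g i)
                  + FD_F N u j (g i) x))) in Hn.
  clearbody next.
  (* [T j] lists the terms up to index [j]; later entries are junk. *)
  pose (T := fix T (j : nat) : nat -> R -> R :=
    match j with
    | O => fun _ => w0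
    | S j => fun i => if Nat.leb i j then T j i else next j (T j)
    end).
  pose (v := fun j => T j j).
  assert (HT : forall j i, (i <= j)%nat -> T j i = v i).
  { induction j as [|j IH]; intros i Hi.
    - now replace i with 0%nat by lia.
    - destruct (Nat.eq_dec i (S j)) as [->|Hne]; [reflexivity|].
      rewrite <- IH by lia. simpl. now rewrite (proj2 (Nat.leb_le i j)) by lia. }
  assert (HvS : forall j, v (S j) = next j (T j)).
  { intros j. unfold v. change (T (S j)) with (fun i => if Nat.leb i j then T j i else next j (T j)).
    cbv beta. now rewrite (proj2 (Nat.leb_gt (S j) j)) by lia. }
  assert (Hc : forall j i, (i <= j)%nat -> continuous_on (ray x0) (v i)).
  { induction j as [|j IH]; intros i Hi.
    - replace i with 0%nat by lia. exact Hw0c.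
    - destruct (Nat.eq_dec i (S j)) as [->|Hne]; [|apply IH; lia].
      rewrite HvS. apply (Hn j (T j)). intros l Hl. rewrite HT by exact Hl. now apply IH. }
  assert (HcT : forall j i, (i <= j)%nat -> continuous_on (ray x0) (T j i)).
  { intros j i Hi. rewrite HT by exact Hi. now apply Hc with j. }
  exists v. split; [|split; [|split; [|split]]].
  - intros j. now apply Hc with j.
  - exact Hw0.
  - exact Hw0d.
  - intros j. rewrite HvS. now apply (Hn j (T j)), HcT.
  - intros j i. rewrite HvS.
    destruct (Hn j (T j) (HcT j)) as [_ [_ H]].
    apply derivative_on_ext with (3 := H i); [reflexivity|].
    intros x _. rewrite (HT j 0%nat) by lia. f_equal. f_equal.
    apply FD_F_ext. intros l y Hl. now rewrite HT.
Qed.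

End Grid.

End Problem.

(** * Summable weights closed under convolution *)

Definition weight (theta : R) (j : nat) : R := theta ^ j * / (INR j + 1) ^ 2.

Lemma INR_succ_pos (j : nat) : 0 < INR j + 1.
Proof. assert (H := pos_INR j). lra. Qed.

Lemma inv_square_pos (j : nat) : 0 < / (INR j + 1) ^ 2.
Proof. apply Rinv_0_lt_compat, pow_lt, INR_succ_pos. Qed.

Lemma weight_pos (theta : R) (j : nat) : 0 <= theta -> 0 <= weight theta j.
Proof.
  intros H. apply Rmult_le_pos; [now apply pow_le | apply Rlt_le, inv_square_pos].
Qed.

Lemma weight_O (theta : R) : weight theta 0 = 1.
Proof. unfold weight. simpl. field. Qed.

Lemma sum_inv_square_le (j : nat) :
  sum_f_R0 (fun i => / (INR i + 1) ^ 2) j <= 2 - / (INR j + 1).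
Proof.
  induction j as [|j IH]; [simpl; lra|].
  rewrite tech5. assert (Hj := INR_succ_pos j). rewrite S_INR in *.
  assert (/ (INR j + 1 + 1) ^ 2 <= / (INR j + 1) - / (INR j + 1 + 1)); [|lra].
  replace (/ (INR j + 1) - / (INR j + 1 + 1))
    with (/ ((INR j + 1) * (INR j + 1 + 1))) by (field; lra).
  apply Rinv_le_contravar; nra.
Qed.

Lemma sum_f_R0_reverse (f : nat -> R) (j : nat) :
  sum_f_R0 (fun i => f (j - i)%nat) j = sum_f_R0 f j.
Proof.
  induction j as [|j IH]; [reflexivity|].
  rewrite decomp_sum by lia. rewrite tech5, <- IH, Nat.sub_0_r. simpl pred.
  rewrite Rplus_comm. reflexivity.
Qed.

(** With [p = i + 1], [q = j - i + 1] and [p + q = j + 2],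
    [1/(pq) = (1/p + 1/q)/(j + 2)], and [(1/p + 1/q)^2 <= 2/p^2 + 2/q^2] has a sum
    bounded uniformly in [j]. *)
Lemma weight_conv (theta : R) (j : nat) : 0 <= theta ->
  PS_mult (weight theta) (weight theta) j <= 8 * weight theta j.
Proof.
  intros Ht.
  replace (PS_mult (weight theta) (weight theta) j)
    with (theta ^ j * sum_f_R0 (fun i => / (INR i + 1) ^ 2 * / (INR (j - i) + 1) ^ 2) j).
  2:{ rewrite scal_sum. apply sum_eq. intros i Hi. unfold weight.
      replace (theta ^ j) with (theta ^ i * theta ^ (j - i)); [ring|].
      rewrite <- pow_add. f_equal. lia. }
  unfold weight. rewrite (Rmult_comm 8), Rmult_assoc.
  apply Rmult_le_compat_l; [now apply pow_le|].
  assert (Hj := INR_succ_pos j).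
  apply Rle_trans with
    (sum_f_R0 (fun i => (/ (INR i + 1) ^ 2 + / (INR (j - i) + 1) ^ 2)
                        * (2 * / (INR j + 1) ^ 2)) j).
  - apply sum_Rle. intros i Hi. rewrite minus_INR by exact Hi.
    apply le_INR in Hi. assert (Hi0 := pos_INR i).
    set (p := INR i + 1). set (q := INR j - INR i + 1). set (n := INR j + 1).
    assert (Hp : 0 < p) by (unfold p; lra). assert (Hq : 0 < q) by (unfold q; lra).
    assert (Hn : 0 < n <= p + q) by (unfold n, p, q; lra).
    replace (/ p ^ 2 * / q ^ 2) with ((/ p + / q) ^ 2 * / (p + q) ^ 2) by (field; lra).
    assert (Hip := Rinv_0_lt_compat p Hp). assert (Hiq := Rinv_0_lt_compat q Hq).
    clearbody p q n.
    replace ((/ p ^ 2 + / q ^ 2) * (2 * / n ^ 2))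
      with (2 * ((/ p) ^ 2 + (/ q) ^ 2) * / n ^ 2) by (field; lra).
    apply Rmult_le_compat; [apply pow2_ge_0 | | |].
    + apply Rlt_le, Rinv_0_lt_compat, pow_lt. lra.
    + assert (H := pow2_ge_0 (/ p - / q)). nra.
    + apply Rinv_le_contravar; [apply pow_lt; lra|]. apply pow_incr. lra.
  - rewrite <- scal_sum, plus_sum, (sum_f_R0_reverse (fun i => / (INR i + 1) ^ 2)).
    assert (H := sum_inv_square_le j). assert (H2 := Rinv_0_lt_compat _ Hj).
    assert (H3 := inv_square_pos j). nra.
Qed.

(** Trades the factor [h] of a freezing error for the passage to the next weight. *)
Lemma weight_step (h r : R) (j : nat) : 0 <= h -> 0 < r ->
  h * weight (h / r) j <= 4 * r * weight (h / r) (S j).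
Proof.
  intros Hh Hr. unfold weight. rewrite S_INR. simpl pow.
  assert (Hj := INR_succ_pos j).
  replace (4 * r * (h / r * (h / r) ^ j * / ((INR j + 1 + 1) * ((INR j + 1 + 1) * 1))))
    with (h * (h / r) ^ j * (4 * / ((INR j + 1 + 1) * ((INR j + 1 + 1) * 1))))
    by (field; lra).
  rewrite <- Rmult_assoc. apply Rmult_le_compat_l.
  - apply Rmult_le_pos; [exact Hh|]. apply pow_le.
    apply Rmult_le_pos; [exact Hh | apply Rlt_le, Rinv_0_lt_compat, Hr].
  - set (n := INR j + 1) in *. assert (1 <= n) by (unfold n; assert (H := pos_INR j); lra).
    replace (4 * / ((n + 1) * ((n + 1) * 1))) with (/ (((n + 1) / 2) * ((n + 1) / 2)))
      by (field; lra).
    apply Rinv_le_contravar; nra.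
Qed.

Lemma ex_series_inv_square : ex_series (fun j => / (INR j + 1) ^ 2).
Proof.
  destruct (ex_finite_lim_seq_incr (sum_n (fun j => / (INR j + 1) ^ 2)) 2) as [l Hl].
  - intros n. rewrite sum_Sn. change plus with Rplus.
    assert (H := inv_square_pos (S n)). lra.
  - intros n. rewrite sum_n_Reals. eapply Rle_trans; [apply sum_inv_square_le|].
    assert (H := Rinv_0_lt_compat _ (INR_succ_pos n)). lra.
  - exists l. exact Hl.
Qed.

Lemma weight_le_inv_square (theta : R) (j : nat) : 0 <= theta <= 1 ->
  weight theta j <= / (INR j + 1) ^ 2.
Proof.
  intros H. unfold weight. rewrite <- (Rmult_1_l (/ _)) at 2.
  apply Rmult_le_compat_r; [apply Rlt_le, inv_square_pos|].
  rewrite <- (pow1 j). now apply pow_incr.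
Qed.

Lemma ex_series_weight (theta : R) : 0 <= theta <= 1 -> ex_series (weight theta).
Proof.
  intros H. apply ex_series_Rabs, ex_series_dominated with (2 := ex_series_inv_square).
  intros j. rewrite Rabs_pos_eq by (apply weight_pos; lra). now apply weight_le_inv_square.
Qed.

(** * The a priori estimate *)

Section Estimate.

Context (x0 : R) (N : R -> R -> R) (phi : R -> R) (a : nat -> R -> R) (B : nat -> R).
Context (a_le_B : forall i x, ray x0 x -> Rabs (a i x) <= B i).
Context (B_entire : forall u, ex_pseries B u).
Context (N_series : forall x u, ray x0 x -> is_pseries (fun i => a i x) u (N x u)).
Context (k alpha : R).
Context (phi_le : forall x, ray x0 x -> Rabs (phi x) <= k).
Context (alpha_gt0 : 0 < alpha).
Context (N_mono : forall x u, ray x0 x -> Derive (fun v => N x v * v) u < - alpha).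

Lemma N_is_derive (x u : R) : ray x0 x -> is_derive (N x) u (Derive (N x) u).
Proof.
  intros Hx. apply Derive_correct. eexists.
  apply (entire_is_derive (fun n => a n x) B); auto.
Qed.

Lemma Nu_is_derive (x u : R) : ray x0 x ->
  is_derive (fun v : R => N x v * v) u (N x u + u * Derive (N x) u).
Proof.
  intros Hx.
  replace (N x u + u * Derive (N x) u)
    with (plus (mult (Derive (N x) u) u) (mult (N x u) 1))
    by (unfold plus, mult; simpl; ring).
  apply (is_derive_mult (N x) (fun v : R => v)); [now apply N_is_derive | | ].
  - apply (is_derive_id (K := R_AbsRing)).
  - apply Rmult_comm.
Qed.

Lemma N_mono_slope (x u : R) : ray x0 x -> N x u + u * Derive (N x) u < - alpha.
Proof.
  intros Hx. rewrite <- (is_derive_unique _ _ _ (Nu_is_derive x u Hx)).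
  now apply N_mono.
Qed.

(** The mean value theorem for [N x v * v]; it yields both the sign of [N] and the
    uniqueness of the solution. *)
Lemma Nu_decreasing (x u v : R) : ray x0 x -> u < v ->
  N x v * v - N x u * u < - alpha * (v - u).
Proof.
  intros Hx Huv.
  destruct (MVT_gen (fun v : R => N x v * v) u v (fun v : R => N x v + v * Derive (N x) v))
    as [c [Hc E]].
  - intros y _. now apply Nu_is_derive.
  - intros y _. apply continuity_pt_filterlim.
    apply (ex_derive_continuous (fun v : R => N x v * v)).
    eexists. now apply Nu_is_derive.
  - cbv beta in E. rewrite E. apply Rmult_lt_compat_r; [lra|]. now apply N_mono_slope.
Qed.

(** Division of [Nu_decreasing] by the argument, as [N x v * v] vanishes at 0. *)
Lemma N_neg (x u : R) : ray x0 x -> N x u < - alpha.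
Proof.
  intros Hx. destruct (Rtotal_order u 0) as [Hu|[->|Hu]].
  - assert (H := Nu_decreasing x u 0 Hx Hu). nra.
  - assert (H := N_mono_slope x 0 Hx). lra.
  - assert (H := Nu_decreasing x 0 u Hx Hu). nra.
Qed.

Context (u0 : R) (g : nat -> R) (u : nat -> R -> R).
Context (g_grid : is_grid x0 g) (u_FD : FD_terms N phi x0 u0 g u).

Lemma grid_left_slope (j : nat) (i : nat) (y : R) : g i < y <= g (S i) ->
  left_slope (u j) (g i) y (FD_rhs N u j (g i) y + first_only (phi y) j).
Proof.
  intros Hy.
  exists (cell g i), (fun x => FD_rhs N u j (g i) x + first_only (phi x) j), (g i).
  split; [lra|]. split; [intros z Hz; split; lra|]. split; [|reflexivity].
  apply (FD_terms_rhs x0 N phi a B a_le_B B_entire N_series u0 g u g_grid u_FD).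
  split; lra.
Qed.

Lemma left_slope_weaken (f : R -> R) (s t y l : R) :
  s <= t -> left_slope f t y l -> left_slope f s y l.
Proof.
  intros Hs (D & d & r & Hr & H). exists D, d, r. split; [lra | exact H].
Qed.

Lemma u_cont (j : nat) : continuous_on (ray x0) (u j).
Proof. apply u_FD. Qed.

Context (M : R) (u0_le : Rabs u0 <= M) (k_lt : k < alpha * M) (M_ge1 : 1 <= M).

(** Since [N < - alpha] and [|phi| <= k < alpha M], the solution decreases in modulus
    wherever it exceeds [M]. *)
Lemma first_term_le (x : R) : ray x0 x -> Rabs (u 0%nat x) <= M.
Proof.
  intros Hx.
  (* [c] is 1 or -1, which treats both signs at once. *)
  assert (H : forall c, Rabs c = 1 -> c * u 0%nat x <= M).
  { intros c Hc.
    assert (H : c * u 0%nat x - (M + 0 * x) <= 0); [|lra].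
    apply (barrier x0 (fun z => c * u 0%nat z - (M + 0 * z)) x0 x).
    - apply continuous_on_minus.
      + apply continuous_on_mult; [apply continuous_on_const | apply u_cont].
      + apply continuous_on_plus; [apply continuous_on_const|].
        apply continuous_on_mult; [apply continuous_on_const | apply continuous_on_id].
    - lra.
    - assert (E : u 0%nat x0 = u0) by apply u_FD. rewrite E.
      assert (c * u0 <= M); [|lra].
      eapply Rle_trans; [apply Rle_abs|]. rewrite Rabs_mult, Hc. lra.
    - intros y Hy Hpos.
      destruct (grid_cell_left_open x0 g y g_grid) as [i Hi]; [lra|].
      assert (Hg := grid_ge x0 g i g_grid).
      apply (left_slope_neg (fun z => c * u 0%nat z - (M + 0 * z)) x0 y
        (c * (FD_rhs N u 0 (g i) y + first_only (phi y) 0) - 0)).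
      + apply left_slope_affine, left_slope_weaken with (g i); [exact Hg|].
        now apply grid_left_slope.
      + assert (Hy' : ray x0 y) by (unfold ray; lra).
        unfold FD_rhs, PS_mult. simpl. rewrite adomian_O.
        assert (H1 := N_neg y (u 0%nat (g i)) Hy').
        assert (H2 : c * phi y <= k).
        { eapply Rle_trans; [apply Rle_abs|]. rewrite Rabs_mult, Hc, Rmult_1_l. auto. }
        assert (Hu : M < c * u 0%nat y) by lra.
        assert (H3 : N y (u 0%nat (g i)) * (c * u 0%nat y) <= - alpha * M).
        { assert (0 <= (c * u 0%nat y - M) * (- N y (u 0%nat (g i)))) by (apply Rmult_le_pos; lra).
          nra. }
        lra.
    - unfold ray in Hx. lra. }
  apply Rabs_le. assert (H1 := H 1 Rabs_R1).
  assert (H2 : -1 * u 0%nat x <= M) by (apply H; rewrite Rabs_left; lra). lra.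
Qed.

(** Smallness conditions: [delta] makes the quadratic part of the recursion
    contract, then [r] absorbs everything that carries a factor [h]. *)
Context (sigma K L delta r h : R).
Context (sigma_eq : sigma = 8 * (1 + M)).
Context (K_eq : K = Series (fun n => B n * sigma ^ n)).
Context (L_eq : L = 8 * M * K + k + 1).
Context (delta_pos : 0 < delta <= 1) (r_pos : 0 < r) (h_le : 0 < h <= r).
Context (delta_small : 8 * K * (8 + M) * delta <= alpha).
Context (r_small1 : 2 * (K * M * (K + K * M) + K * L) * r <= alpha).
Context (r_small2 : K * M * r <= 1).
Context (r_small3 : 32 * K * L * M * r <= 1).
Context (r_small4 : 256 * K * L * M * r <= alpha * delta).
Context (step_le : forall i, g (S i) - g i <= h).

Notation W := (weight (h / r)).

Lemma theta_bounds : 0 <= h / r <= 1.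
Proof.
  assert (Hr := Rinv_0_lt_compat r r_pos). unfold Rdiv. split; [nra|].
  rewrite <- (Rinv_r r) by lra. apply Rmult_le_compat_r; lra.
Qed.

Lemma W_ge0 (j : nat) : 0 <= W j.
Proof. apply weight_pos, theta_bounds. Qed.

Lemma W_conv (j : nat) : PS_mult W W j <= 8 * W j.
Proof. apply weight_conv, theta_bounds. Qed.

Lemma k_ge0 : 0 <= k.
Proof.
  eapply Rle_trans; [apply Rabs_pos | apply (phi_le x0)]. apply Rle_refl.
Qed.

(** Both bounds are needed: the term of index 0 is not small. *)
Definition terms_bounded (j : nat) : Prop := forall i x, (i <= j)%nat -> ray x0 x ->
  Rabs (u i x) <= M * W i /\ ((1 <= i)%nat -> Rabs (u i x) <= delta * W i).

Definition terms_lipschitz (j : nat) : Prop := forall i c x, (i <= j)%nat -> cell g c x ->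
  Rabs (u i x - u i (g c)) <= h * L * W i.

Lemma adomian_le (j : nat) (x s : R) (q : nat) :
  terms_bounded j -> (q <= j)%nat -> ray x0 x -> ray x0 s ->
  Rabs (adomian q (N x) (fun i => u i s)) <= K * W q.
Proof.
  intros Hb Hq Hx Hs. rewrite K_eq.
  apply (adomian_weight (fun n => a n x) B) with (M := M) (kappa := 8); auto;
    try lra; try apply W_ge0; try apply W_conv.
  - apply weight_O.
  - intros i Hi. apply (Hb i s); [lia | exact Hs].
Qed.

Lemma K_ge0 : 0 <= K.
Proof.
  assert (H : Rabs (adomian 0 (N x0) (fun _ => 0)) <= K * W 0%nat).
  { rewrite K_eq.
    apply (adomian_weight (fun n => a n x0) B) with (M := M) (kappa := 8); auto;
      try lra; try apply W_ge0; try apply W_conv.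
    - intros n. apply a_le_B. apply Rle_refl.
    - intros z. apply N_series. apply Rle_refl.
    - apply weight_O.
    - intros i Hi. rewrite Rabs_R0. assert (H := W_ge0 i). nra. }
  rewrite weight_O in H. assert (H1 := Rabs_pos (adomian 0 (N x0) (fun _ => 0))). lra.
Qed.

Lemma L_ge0 : 0 <= L.
Proof. assert (H1 := K_ge0). assert (H2 := k_ge0). rewrite L_eq. nra. Qed.

Lemma adomian_diff_le (j : nat) (c : nat) (x : R) (q : nat) :
  terms_bounded j -> terms_lipschitz j -> (q <= j)%nat -> cell g c x ->
  Rabs (adomian q (N x) (fun i => u i x) - adomian q (N x) (fun i => u i (g c)))
  <= h * L * K * W q.
Proof.
  intros Hb Hl Hq Hc. rewrite K_eq.
  assert (Hx := cell_ray x0 g c x g_grid Hc).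
  assert (Hs : ray x0 (g c)) by apply (grid_ge x0 g c g_grid).
  apply (adomian_diff_weight (fun n => a n x) B) with (M := M) (kappa := 8); auto;
    try lra; try apply W_ge0; try apply W_conv.
  - apply weight_O.
  - assert (H := L_ge0). apply Rmult_le_pos; lra.
  - intros i Hi. apply (Hb i x); [lia | exact Hx].
  - intros i Hi. apply (Hb i (g c)); [lia | exact Hs].
  - intros i Hi. apply Hl; [lia | exact Hc].
Qed.

Lemma freezing_error_le (j : nat) (c : nat) (x : R) :
  terms_bounded j -> terms_lipschitz j -> cell g c x ->
  Rabs (PS_mult (fun i => u i x)
          (fun q => adomian q (N x) (fun i => u i x)
                    - adomian q (N x) (fun i => u i (g c))) j)
  <= 32 * K * L * M * r * W (S j).
Proof.
  intros Hb Hl Hc. assert (HK := K_ge0). assert (HL := L_ge0).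
  assert (Hx := cell_ray x0 g c x g_grid Hc).
  eapply Rle_trans.
  - apply PS_mult_weight with (W := W) (kappa := 8) (c := M) (d := h * L * K).
    + apply W_conv.
    + lra.
    + apply Rmult_le_pos; [apply Rmult_le_pos; lra | exact HK].
    + intros i Hi. now apply (Hb i x).
    + intros q Hq. now apply (adomian_diff_le j c).
  - assert (H := weight_step h r j).
    assert (H1 : h * W j <= 4 * r * W (S j)) by (apply H; lra).
    replace (8 * M * (h * L * K) * W j) with (8 * M * L * K * (h * W j)) by ring.
    replace (32 * K * L * M * r * W (S j)) with (8 * M * L * K * (4 * r * W (S j))) by ring.
    apply Rmult_le_compat_l; [|exact H1].
    apply Rmult_le_pos; [|exact HK]. apply Rmult_le_pos; lra.
Qed.

(** The coefficient of the frozen series takes [8 M K] of the constant [L], the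
    freezing error at most 1. *)
Lemma FD_rhs_le (j : nat) (c : nat) (x : R) :
  terms_bounded (S j) -> terms_lipschitz j -> cell g c x ->
  Rabs (FD_rhs N u (S j) (g c) x) <= L * W (S j).
Proof.
  intros Hb Hl Hc. assert (HK := K_ge0). assert (HL := L_ge0).
  assert (Hx := cell_ray x0 g c x g_grid Hc).
  assert (Hs : ray x0 (g c)) by apply (grid_ge x0 g c g_grid).
  unfold FD_rhs. eapply Rle_trans; [apply Rabs_triang|].
  assert (H1 : Rabs (PS_mult (fun i => u i x)
      (fun q => adomian q (N x) (fun i => u i (g c))) (S j)) <= 8 * M * K * W (S j)).
  { apply PS_mult_weight; [apply W_conv | lra | exact HK | |].
    - intros i Hi. now apply (Hb i x).
    - intros q Hq. now apply adomian_le with (S j). }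
  assert (H2 : Rabs (PS_mult (fun i => u i x)
          (fun q => adomian q (N x) (fun i => u i x)
                    - adomian q (N x) (fun i => u i (g c))) j)
     <= 32 * K * L * M * r * W (S j)).
  { apply freezing_error_le; auto. intros i y Hi. apply Hb. lia. }
  assert (HW := W_ge0 (S j)). assert (Hk := k_ge0).
  assert (32 * K * L * M * r * W (S j) <= 1 * W (S j)) by now apply Rmult_le_compat_r.
  assert (0 <= k * W (S j)) by now apply Rmult_le_pos.
  assert (E : L * W (S j) = 8 * M * K * W (S j) + k * W (S j) + 1 * W (S j))
    by (rewrite L_eq; ring).
  lra.
Qed.

Lemma FD_rhs_O_le (c : nat) (x : R) : terms_bounded 0 -> cell g c x ->
  Rabs (FD_rhs N u 0 (g c) x + phi x) <= L.
Proof.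
  intros Hb Hc. assert (HK := K_ge0).
  assert (Hx := cell_ray x0 g c x g_grid Hc).
  assert (Hs : ray x0 (g c)) by apply (grid_ge x0 g c g_grid).
  unfold FD_rhs, PS_mult. simpl. rewrite Rplus_0_r.
  eapply Rle_trans; [apply Rabs_triang|]. rewrite Rabs_mult.
  assert (H1 := adomian_le 0 x (g c) 0 Hb (Nat.le_refl 0) Hx Hs).
  assert (H2 := first_term_le x Hx). assert (H3 := phi_le x Hx).
  rewrite weight_O, Rmult_1_r in H1.
  assert (Rabs (u 0%nat x) * Rabs (adomian 0 (N x) (fun i => u i (g c))) <= M * K).
  { apply Rmult_le_compat; try apply Rabs_pos; assumption. }
  rewrite L_eq. nra.
Qed.

Lemma FD_rhs_phi_le (j : nat) (c : nat) (x : R) :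
  terms_bounded j -> terms_lipschitz (pred j) -> cell g c x ->
  Rabs (FD_rhs N u j (g c) x + first_only (phi x) j) <= L * W j.
Proof.
  destruct j as [|j]; intros Hb Hl Hc; simpl first_only.
  - rewrite weight_O, Rmult_1_r. now apply FD_rhs_O_le.
  - rewrite Rplus_0_r. now apply FD_rhs_le.
Qed.

Lemma next_term_lipschitz (j : nat) :
  terms_bounded j -> terms_lipschitz (pred j) ->
  forall c x, cell g c x -> Rabs (u j x - u j (g c)) <= h * L * W j.
Proof.
  intros Hb Hl c x Hc.
  assert (HL : 0 <= L * W j) by (apply Rmult_le_pos; [apply L_ge0 | apply W_ge0]).
  apply Rle_trans with (L * W j * (x - g c)).
  - apply (mean_value_abs x0 (u j) (g c) x).
    + apply u_cont.
    + apply (grid_ge x0 g c g_grid).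
    + intros y Hy. destruct Hc as [Hc1 Hc2]. eexists. split.
      * apply grid_left_slope. lra.
      * apply FD_rhs_phi_le; auto. split; lra.
    + destruct Hc as [Hc1 Hc2]. lra.
  - destruct Hc as [Hc1 Hc2]. specialize (step_le c).
    replace (h * L * W j) with (L * W j * h) by ring.
    apply Rmult_le_compat_l; lra.
Qed.

Notation F_bound := (delta ^ 2 * K * (8 + M) + 32 * K * L * M * r).

(** The source of the next term: Cauchy products of two terms of positive index
    are of order [delta ^ 2], and freezing [u] at the left end costs a factor
    [h]. *)
Lemma FD_F_le (j : nat) (c : nat) (x : R) :
  terms_bounded j -> terms_lipschitz j -> cell g c x ->
  Rabs (FD_F N u j (g c) x) <= F_bound * W (S j).
Proof.
  intros Hb Hl Hc. assert (HK := K_ge0).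
  assert (Hx := cell_ray x0 g c x g_grid Hc).
  assert (Hs : ray x0 (g c)) by apply (grid_ge x0 g c g_grid).
  rewrite FD_F_eq.
  assert (H1 : Rabs (PS_mult (drop_head (fun i => u i x))
      (drop_head (fun q => adomian q (N x) (fun i => u i (g c)))) (S j))
      <= 8 * delta * (delta * K) * W (S j)).
  { apply PS_mult_inner_weight; [apply W_ge0 | apply W_conv | lra | nra | |].
    - intros i Hi. apply Hb; [lia | exact Hx | lia].
    - intros [|q] Hq; [lia|]. rewrite K_eq.
      apply (adomian_small (fun n => a n x) B) with (M := M) (kappa := 8); auto;
        try lra; try apply W_ge0; try apply W_conv.
      + apply weight_O.
      + intros i Hi. apply Hb; [lia | exact Hs].
      + intros i Hi. apply Hb; [lia | exact Hs | lia]. }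
  assert (H2 := freezing_error_le j c x Hb Hl Hc).
  assert (H3 : Rabs (adomian (S j) (N x) (truncate j (fun i => u i (g c))))
      <= delta ^ 2 * K * W (S j)).
  { rewrite K_eq.
    apply (adomian_quadratic (fun n => a n x) B) with (M := M) (kappa := 8); auto;
      try lra; try apply W_ge0; try apply W_conv.
    - apply weight_O.
    - intros i Hi. unfold truncate. destruct (Nat.leb_spec i j) as [H|H].
      + now apply Hb.
      + rewrite Rabs_R0. assert (HW := W_ge0 i). nra.
    - intros i Hi. unfold truncate. destruct (Nat.leb_spec i j) as [H|H].
      + apply Hb; [lia | exact Hs | lia].
      + rewrite Rabs_R0. assert (HW := W_ge0 i). nra.
    - unfold truncate. now rewrite (proj2 (Nat.leb_gt (S j) j)) by lia. }
  assert (H4 := first_term_le x Hx).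
  assert (H5 : Rabs (adomian (S j) (N x) (truncate j (fun i => u i (g c))) * u 0%nat x)
     <= delta ^ 2 * K * W (S j) * M).
  { rewrite Rabs_mult. apply Rmult_le_compat; try apply Rabs_pos; assumption. }
  eapply Rle_trans; [apply Rabs_triang|].
  eapply Rle_trans; [apply Rplus_le_compat_r, Rabs_triang|].
  replace (F_bound * W (S j)) with (8 * delta * (delta * K) * W (S j)
    + 32 * K * L * M * r * W (S j) + delta ^ 2 * K * W (S j) * M) by ring.
  lra.
Qed.

(** The linear problem for the next term is dissipative.  Its coefficients
    [N x (u 0 s)] and [u 0 s * Derive (N x) (u 0 s)] add up to less than [- alpha],
    but the second multiplies the delayed value at [s]; replacing it by the
    current value costs [h] times the largest slope.  At a point where the
    modulus of the term is maximal the derivative therefore has the sign of the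
    damping unless the modulus is at most a multiple of the source. *)
Lemma next_term_bounded (j : nat) :
  terms_bounded j -> terms_lipschitz j ->
  forall x, ray x0 x -> Rabs (u (S j) x) <= delta * W (S j).
Proof.
  intros Hb Hl X HX. assert (HK := K_ge0). assert (HL := L_ge0).
  assert (HW := W_ge0 (S j)).
  destruct (continuous_on_max x0 (fun z => Rabs (u (S j) z)) x0 X) as [y [Hy Hmax]].
  { apply continuous_on_abs, u_cont. }
  { unfold ray in HX. lra. }
  cbv beta in Hmax.
  (* The largest modulus on [x0, X], attained at [y]. *)
  set (T := Rabs (u (S j) y)) in *.
  assert (HXy : Rabs (u (S j) X) <= T) by (apply Hmax; unfold ray in HX; lra).
  destruct (Rle_lt_dec T (delta * W (S j))) as [H|HT]; [lra | exfalso].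
  assert (HT0 : 0 < T) by nra.
  assert (E0 : u (S j) x0 = 0) by apply u_FD.
  assert (Hyne : y <> x0).
  { intros E. unfold T in HT0. rewrite E, E0, Rabs_R0 in HT0. lra. }
  destruct (grid_cell_left_open x0 g y g_grid) as [i Hi]; [lra|].
  set (s := g i) in *.
  assert (Hs : x0 <= s) by apply (grid_ge x0 g i g_grid).
  assert (Hcell : forall z, s < z <= y -> cell g i z) by (intros z Hz; split; unfold s in *; lra).
  assert (HF : forall z, s < z <= y -> Rabs (FD_F N u j s z) <= F_bound * W (S j)).
  { intros z Hz. apply FD_F_le; auto. }
  assert (Hu0s : Rabs (u 0%nat s) <= M) by (apply first_term_le; exact Hs).
  assert (HD : forall z, ray x0 z -> Rabs (Derive (N z) (u 0%nat s)) <= K).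
  { intros z Hz. rewrite K_eq.
    apply (entire_Derive_le (fun n => a n z) B); auto. rewrite sigma_eq. lra. }
  assert (HN : forall z, ray x0 z -> Rabs (N z (u 0%nat s)) <= K).
  { intros z Hz. assert (H := adomian_le j z s 0 Hb (Nat.le_0_l j) Hz Hs).
    rewrite adomian_O, weight_O, Rmult_1_r in H. exact H. }
  assert (Hvs : Rabs (u (S j) s) <= T) by (apply Hmax; lra).
  set (v := u (S j)) in *. set (Fb := F_bound * W (S j)) in *.
  assert (HFb0 : 0 <= Fb).
  { eapply Rle_trans; [apply Rabs_pos | apply (HF y)]. lra. }
  assert (Hslope : forall z, s < z <= y -> left_slope v s z
     (N z (u 0%nat s) * v z
      + (Derive (N z) (u 0%nat s) * u 0%nat z * v s + FD_F N u j s z))).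
  { intros z Hz.
    assert (H := grid_left_slope (S j) i z).
    rewrite <- (FD_rhs_S x0 N a B) in H; auto.
    - simpl first_only in H. rewrite Rplus_0_r in H. apply H. unfold s in *; lra.
    - unfold ray; lra. }
  assert (Hdelay : Rabs (v y - v s) <= ((K + K * M) * T + Fb) * h).
  { apply Rle_trans with (((K + K * M) * T + Fb) * (y - s)).
    - apply (mean_value_abs x0 v s y); [apply u_cont | exact Hs | | lra].
      intros z Hz. eexists. split; [now apply Hslope|].
      assert (Hzr : ray x0 z) by (unfold ray; lra).
      eapply Rle_trans; [apply Rabs_triang|].
      replace ((K + K * M) * T + Fb) with (K * T + (K * M * T + Fb)) by ring.
      apply Rplus_le_compat.
      + rewrite Rabs_mult. apply Rmult_le_compat; try apply Rabs_pos; [now apply HN|].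
        apply Hmax. lra.
      + eapply Rle_trans; [apply Rabs_triang|]. apply Rplus_le_compat; [|now apply HF].
        rewrite !Rabs_mult.
        apply Rmult_le_compat; try apply Rabs_pos; [| |exact Hvs].
        * apply Rmult_le_pos; apply Rabs_pos.
        * apply Rmult_le_compat; try apply Rabs_pos; [now apply HD | now apply first_term_le].
    - assert (y - s <= h) by (specialize (step_le i); unfold s in *; lra).
      apply Rmult_le_compat_l; [|assumption].
      assert (0 <= (K + K * M) * T) by (apply Rmult_le_pos; [nra | lra]). lra. }
  assert (Hyr : ray x0 y) by (unfold ray; lra).
  assert (Hdrift : Rabs (u 0%nat y - u 0%nat s) <= h * L).
  { assert (H := Hl 0%nat i y (Nat.le_0_l j) (Hcell y (conj (proj1 Hi) (Rle_refl y)))).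
    rewrite weight_O, Rmult_1_r in H. exact H. }
  (* [c] is the sign of the term at [y]. *)
  assert (Hsg : exists c, Rabs c = 1 /\ c * v y = T).
  { unfold T. fold v. destruct (Rle_lt_dec 0 (v y)) as [Hv|Hv].
    - exists 1. rewrite Rabs_R1, Rabs_pos_eq by lra. split; ring.
    - exists (-1). rewrite !Rabs_left by lra. split; ring. }
  destruct Hsg as [c [Hc HcT]].
  destruct (left_slope_neg (fun z => c * v z - (0 + 0 * z)) s y
     (c * (N y (u 0%nat s) * v y
      + (Derive (N y) (u 0%nat s) * u 0%nat y * v s + FD_F N u j s y)) - 0))
    as [z [Hz Hlt]].
  - apply left_slope_affine, Hslope. lra.
  - set (p := N y (u 0%nat s)). set (q := Derive (N y) (u 0%nat s)).
    assert (Hpq : p + u 0%nat s * q < - alpha) by now apply N_mono_slope.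
    assert (Hq : Rabs q <= K) by now apply HD.
    (* The delayed value and [u 0 y] are replaced by [v y] and [u 0 s], which
       collects [p + u 0 s * q]. *)
    assert (E1 : c * (p * v y + (q * u 0%nat y * v s + FD_F N u j s y)) - 0
      = (p + u 0%nat s * q) * T + c * (q * u 0%nat s * (v s - v y)
         + q * (u 0%nat y - u 0%nat s) * v s + FD_F N u j s y)).
    { rewrite <- HcT. ring. }
    rewrite E1.
    assert (H2 : c * (q * u 0%nat s * (v s - v y)
         + q * (u 0%nat y - u 0%nat s) * v s + FD_F N u j s y)
      <= K * M * (((K + K * M) * T + Fb) * h) + K * (h * L) * T + Fb).
    { eapply Rle_trans; [apply Rle_abs|]. rewrite Rabs_mult, Hc, Rmult_1_l.
      eapply Rle_trans; [apply Rabs_triang|]. apply Rplus_le_compat.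
      - eapply Rle_trans; [apply Rabs_triang|]. apply Rplus_le_compat.
        + rewrite !Rabs_mult, (Rabs_minus_sym (v s)).
          apply Rmult_le_compat; try apply Rabs_pos; [| |exact Hdelay].
          * apply Rmult_le_pos; apply Rabs_pos.
          * apply Rmult_le_compat; try apply Rabs_pos; assumption.
        + rewrite !Rabs_mult.
          apply Rmult_le_compat; try apply Rabs_pos; [| |exact Hvs].
          * apply Rmult_le_pos; apply Rabs_pos.
          * apply Rmult_le_compat; try apply Rabs_pos; assumption.
      - apply HF. lra. }
    assert (H3 : (p + u 0%nat s * q) * T < - alpha * T) by now apply Rmult_lt_compat_r.
    assert (HP : 0 <= K * M * (K + K * M) + K * L).
    { apply Rplus_le_le_0_compat; [|now apply Rmult_le_pos].
      apply Rmult_le_pos; nra. }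
    assert (HKM : 0 <= K * M) by nra.
    assert (H4 : 2 * (K * M * (K + K * M) + K * L) * h <= alpha).
    { eapply Rle_trans; [|exact r_small1]. apply Rmult_le_compat_l; lra. }
    assert (H5 : K * M * h <= 1).
    { eapply Rle_trans; [|exact r_small2]. apply Rmult_le_compat_l; lra. }
    assert (H6 : 2 * (K * M * (K + K * M) + K * L) * h * T <= alpha * T)
      by (apply Rmult_le_compat_r; lra).
    assert (H7 : K * M * h * Fb <= 1 * Fb) by now apply Rmult_le_compat_r.
    assert (H8 : 4 * Fb <= alpha * (delta * W (S j))).
    { unfold Fb. rewrite <- !Rmult_assoc. apply Rmult_le_compat_r; [exact HW|].
      assert (8 * K * (8 + M) * delta * delta <= alpha * delta)
        by (apply Rmult_le_compat_r; lra).
      lra. }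
    assert (H9 : alpha * (delta * W (S j)) < alpha * T) by now apply Rmult_lt_compat_l.
    lra.
  - assert (Hzm : Rabs (v z) <= T) by (apply Hmax; lra).
    assert (c * v z <= T).
    { eapply Rle_trans; [apply Rle_abs|]. rewrite Rabs_mult, Hc. lra. }
    cbv beta in Hlt. lra.
Qed.

(** For each index the bound comes first: it controls the slope of that same term,
    whence its variation on a cell. *)
Lemma all_terms (j : nat) : terms_bounded j /\ terms_lipschitz j.
Proof.
  assert (Hstep : forall l, terms_bounded l -> terms_lipschitz (pred l) ->
    terms_lipschitz l).
  { intros l Hb Hl i c x Hi Hc. destruct (Nat.eq_dec i l) as [->|Hne].
    - now apply next_term_lipschitz.
    - apply Hl; [lia | exact Hc]. }
  induction j as [|j [IHb IHl]].
  - assert (Hb : terms_bounded 0).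
    { intros i x Hi Hx. replace i with 0%nat by lia. split; [|lia].
      rewrite weight_O, Rmult_1_r. now apply first_term_le. }
    split; [exact Hb|]. intros i c x Hi Hc. replace i with 0%nat by lia.
    assert (HL := L_ge0).
    apply Rle_trans with (L * (x - g c)).
    + apply (mean_value_abs x0 (u 0%nat) (g c) x);
        [apply u_cont | apply (grid_ge x0 g c g_grid) | | destruct Hc; lra].
      intros y Hy. destruct Hc as [Hc1 Hc2]. eexists. split.
      * apply grid_left_slope. lra.
      * simpl first_only. apply FD_rhs_O_le; auto. split; lra.
    + rewrite weight_O, Rmult_1_r, (Rmult_comm h). destruct Hc as [Hc1 Hc2].
      specialize (step_le c). apply Rmult_le_compat_l; lra.
  - assert (Hb : terms_bounded (S j)).
    { intros i x Hi Hx. destruct (Nat.eq_dec i (S j)) as [->|Hne].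
      - assert (H := next_term_bounded j IHb IHl x Hx). split; [|auto].
        eapply Rle_trans; [exact H|]. apply Rmult_le_compat_r; [apply W_ge0 | lra].
      - apply IHb; [lia | exact Hx]. }
    split; [exact Hb|]. now apply Hstep.
Qed.

Lemma terms_le (j : nat) (x : R) : ray x0 x -> Rabs (u j x) <= M * W j.
Proof. intros Hx. now apply (proj1 (all_terms j)). Qed.

Lemma rhs_le (j : nat) (c : nat) (x : R) : cell g c x ->
  Rabs (FD_rhs N u j (g c) x + first_only (phi x) j) <= L * W j.
Proof. intros Hc. apply FD_rhs_phi_le; [apply all_terms | apply all_terms | exact Hc]. Qed.

End Estimate.

(** * Tails, suprema and the choice of constants *)

Lemma derivative_on_sum (D : R -> Prop) (u d : nat -> R -> R) (m : nat) :
  (forall j, derivative_on D (u j) (d j)) ->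
  derivative_on D (partial_sum u m) (fun x => sum_n (fun j => d j x) m).
Proof.
  intros H. apply derivative_on_ext with
    (f := fun x => sum_f_R0 (fun j => u j x) m) (d := fun x => sum_f_R0 (fun j => d j x) m).
  - intros x _. unfold partial_sum. now rewrite sum_n_Reals.
  - intros x _. now rewrite sum_n_Reals.
  - induction m as [|m IH]; intros x Dx; simpl; [now apply H|].
    apply Dadd; [now apply IH | now apply H].
Qed.

Lemma continuous_on_partial_sum (D : R -> Prop) (u : nat -> R -> R) (m : nat) :
  (forall j, continuous_on D (u j)) -> continuous_on D (partial_sum u m).
Proof.
  intros H. apply continuous_on_ext_R with (fun x => sum_f_R0 (fun j => u j x) m).
  - intros x _. unfold partial_sum. now rewrite sum_n_Reals.
  - now apply continuous_on_sum.
Qed.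

Lemma Rpower_square (y : R) : 0 < y -> Rpower y (1 + 1) = y ^ 2.
Proof. intros Hy. rewrite Rpower_plus, Rpower_1 by exact Hy. ring. Qed.

Lemma weight_tail_one (m : nat) :
  Series (fun i => weight 1 (S m + i))
  = Series (fun i => / Rpower (INR (m + 1 + i) + 1) (1 + 1)).
Proof.
  apply Series_ext. intros i. unfold weight.
  rewrite pow1, Rmult_1_l, Rpower_square by apply INR_succ_pos.
  replace (m + 1 + i)%nat with (S m + i)%nat by lia. reflexivity.
Qed.

Lemma weight_tail_lt_one (theta : R) (m : nat) : 0 <= theta < 1 ->
  Series (fun i => weight theta (S m + i))
  <= / Rpower (1 + INR m) (1 + 1) * (theta ^ (m + 1) / (1 - theta)).
Proof.
  intros Ht. assert (Hm := pos_INR m).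
  rewrite Rpower_square by lra. unfold Rdiv. rewrite <- Rmult_assoc.
  rewrite <- Series_geom by (rewrite Rabs_pos_eq; lra). rewrite <- Series_scal_l.
  apply Series_le.
  - intros i. split; [apply weight_pos; lra|]. unfold weight.
    replace (theta ^ (S m + i)) with (theta ^ (m + 1) * theta ^ i)
      by (rewrite <- pow_add; f_equal; lia).
    replace (/ (1 + INR m) ^ 2 * theta ^ (m + 1) * theta ^ i)
      with (theta ^ (m + 1) * theta ^ i * / (1 + INR m) ^ 2) by ring.
    apply Rmult_le_compat_l.
    + apply Rmult_le_pos; apply pow_le; lra.
    + apply Rinv_le_contravar; [apply pow_lt; lra|]. apply pow_incr.
      rewrite plus_INR, S_INR. assert (Hi := pos_INR i). lra.
  - apply (ex_series_scal (V := R_NormedModule)).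
    apply ex_series_geom. rewrite Rabs_pos_eq; lra.
Qed.

Lemma sup_abs_le (x0 : R) (f : R -> R) (c : R) :
  (forall x, ray x0 x -> Rabs (f x) <= c) -> Rbar_le (sup_abs x0 f) c.
Proof.
  intros H. apply (proj2 (Lub_Rbar_correct _)). intros y [x [Hx ->]]. now apply H.
Qed.

Lemma le_sup_abs (x0 : R) (f : R -> R) (c x : R) :
  Rbar_le (sup_abs x0 f) c -> ray x0 x -> Rabs (f x) <= c.
Proof.
  intros H Hx.
  assert (H1 : Rbar_le (Rabs (f x)) (sup_abs x0 f)).
  { apply (proj1 (Lub_Rbar_correct _)). now exists x. }
  exact (Rbar_le_trans _ _ _ H1 H).
Qed.

Lemma uniform_grid (x0 r : R) : 0 < r -> is_grid x0 (fun i => x0 + r * INR i).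
Proof.
  intros Hr. split; [simpl; ring|]. split.
  - intros i. rewrite S_INR. nra.
  - apply is_lim_seq_spec. intros A.
    destruct (INR_unbounded ((A - x0) / r)) as [n Hn].
    exists n. intros i Hi. apply le_INR in Hi.
    assert (E : A = x0 + r * ((A - x0) / r)) by (field; lra).
    rewrite E. apply Rplus_lt_compat_l, Rmult_lt_compat_l; lra.
Qed.

(** [delta] comes first: the last condition asks that [r] be small compared with it. *)
Lemma small_parameters (alpha M K L : R) :
  0 < alpha -> 1 <= M -> 0 <= K -> 0 <= L ->
  exists delta r, 0 < delta <= 1 /\ 0 < r /\
    8 * K * (8 + M) * delta <= alpha /\
    2 * (K * M * (K + K * M) + K * L) * r <= alpha /\
    K * M * r <= 1 /\ 32 * K * L * M * r <= 1 /\
    256 * K * L * M * r <= alpha * delta.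
Proof.
  intros Ha HM HK HL.
  assert (HKM : 0 <= K * M) by nra.
  assert (HKL : 0 <= K * L) by nra.
  assert (HKLM : 0 <= K * L * M) by nra.
  assert (HP : 0 <= K * M * (K + K * M)) by nra.
  pose (delta := alpha / (alpha + 8 * K * (8 + M))).
  assert (HA : 0 < alpha + 8 * K * (8 + M)) by nra.
  assert (Hd : 0 < delta) by (now apply Rdiv_lt_0_compat).
  assert (Ed : delta * alpha + 8 * K * (8 + M) * delta = alpha)
    by (unfold delta; field; lra).
  assert (Hd1 : delta <= 1).
  { assert (0 <= 8 * K * (8 + M) * delta) by (apply Rmult_le_pos; nra). nra. }
  pose (e := Rmin (Rmin alpha 1) (alpha * delta)).
  assert (Had : 0 < alpha * delta) by now apply Rmult_lt_0_compat.
  assert (He : 0 < e) by (apply Rmin_glb_lt; [apply Rmin_glb_lt|]; lra).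
  assert (He1 : e <= alpha) by (eapply Rle_trans; [apply Rmin_l | apply Rmin_l]).
  assert (He2 : e <= 1) by (eapply Rle_trans; [apply Rmin_l | apply Rmin_r]).
  assert (He3 : e <= alpha * delta) by apply Rmin_r.
  pose (Z := 1 + 2 * (K * M * (K + K * M) + K * L) + K * M + 256 * K * L * M).
  assert (HZ : 0 < Z) by (unfold Z; lra).
  assert (Hr : forall c, c <= Z -> c * (e / Z) <= e).
  { intros c Hc. replace (c * (e / Z)) with (c / Z * e) by (field; lra).
    rewrite <- (Rmult_1_l e) at 2. apply Rmult_le_compat_r; [lra|].
    apply Rle_div_l; lra. }
  exists delta, (e / Z). split; [lra|]. split; [now apply Rdiv_lt_0_compat|].
  split; [nra|].
  split; [|split; [|split]]; (eapply Rle_trans; [apply Hr; unfold Z; lra | assumption]).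
Qed.

(** * Convergence to the solution *)

Section Convergence.

Context (x0 : R) (N : R -> R -> R) (phi : R -> R) (a : nat -> R -> R) (B : nat -> R).
Context (a_cont : forall i, continuous_on (ray x0) (a i)).
Context (a_le_B : forall i x, ray x0 x -> Rabs (a i x) <= B i).
Context (B_entire : forall u, ex_pseries B u).
Context (N_series : forall x u, ray x0 x -> is_pseries (fun i => a i x) u (N x u)).
Context (phi_cont : continuous_on (ray x0) phi).

(** Cauchy products of absolutely convergent series.  With [N x] evaluated at the
    sums [U] at [x] and [Us] at [s], the two parts add up to
    [U * N x Us + U * (N x U - N x Us)]. *)
Lemma FD_rhs_series (u : nat -> R -> R) (s x : R) : ray x0 x ->
  ex_series (fun j => Rabs (u j x)) -> ex_series (fun j => Rabs (u j s)) ->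
  is_series (fun j => FD_rhs N u j s x)
    (N x (Series (fun j => u j x)) * Series (fun j => u j x)).
Proof.
  intros Hx Hux Hus.
  destruct (adomian_series (fun n => a n x) B (N x)) with (v := fun j => u j x)
    as [Ax Ax']; auto.
  destruct (adomian_series (fun n => a n x) B (N x)) with (v := fun j => u j s)
    as [As As']; auto.
  set (U := Series (fun j => u j x)) in *. set (Us := Series (fun j => u j s)) in *.
  assert (HU : is_series (fun j => u j x) U) by apply Series_correct, ex_series_Rabs, Hux.
  assert (H1 := is_series_mult _ _ _ _ HU As Hux As').
  assert (Hd := is_series_minus _ _ _ _ Ax As).
  assert (Hd' : ex_series (fun j => Rabs (adomian j (N x) (fun i => u i x)
                                     - adomian j (N x) (fun i => u i s)))).
  { apply ex_series_dominated with (b := fun j => Rabs (adomian j (N x) (fun i => u i x))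
                                     + Rabs (adomian j (N x) (fun i => u i s))).
    - intros j. unfold Rminus. eapply Rle_trans; [apply Rabs_triang|].
      rewrite Rabs_Ropp. apply Rle_refl.
    - now apply (ex_series_plus (V := R_NormedModule)). }
  assert (H2 := is_series_mult _ _ _ _ HU Hd Hux Hd').
  replace (N x U * U) with (plus (U * N x Us) (U * minus (N x U) (N x Us)))
    by (unfold plus, minus, opp; simpl; unfold plus, opp; simpl; ring).
  apply (is_series_plus (V := R_NormedModule)); [exact H1|].
  apply (is_series_decr_1 (V := R_NormedModule)).
  replace (plus _ _) with (U * minus (N x U) (N x Us)); [exact H2|].
  unfold plus, minus, opp; simpl; unfold plus, opp; simpl; ring.
Qed.

(** The right-hand sides sum to [N x (U x) * U x + phi x] pointwise, where [U] is the
    sum of the terms, and are dominated uniformly.  So the partial sums approach the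
    antiderivative of this function, which must then be [U]. *)
Lemma FD_sum_solves (u0 : R) (g : nat -> R) (u : nat -> R -> R) (M L theta : R) :
  is_grid x0 g -> FD_terms N phi x0 u0 g u -> 0 <= theta <= 1 ->
  (forall j x, ray x0 x -> Rabs (u j x) <= M * weight theta j) ->
  (forall j c x, cell g c x ->
     Rabs (FD_rhs N u j (g c) x + first_only (phi x) j) <= L * weight theta j) ->
  exists U, solves_cauchy N phi x0 u0 U /\
    forall m x, ray x0 x ->
      Rabs (U x - partial_sum u m x) <= Series (fun i => M * weight theta (S m + i)).
Proof.
  intros Hg Hu Ht Hub Hrb.
  assert (HM : ex_series (fun j => M * weight theta j))
    by now apply (ex_series_scal (V := R_NormedModule)), ex_series_weight.
  assert (HL : ex_series (fun j => L * weight theta j))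
    by now apply (ex_series_scal (V := R_NormedModule)), ex_series_weight.
  assert (Habs : forall x, ray x0 x -> ex_series (fun j => Rabs (u j x))).
  { intros x Hx. apply ex_series_dominated with (2 := HM). intros j. now apply Hub. }
  pose (U := fun x => Series (fun j => u j x)).
  assert (Hrem : forall m x, ray x0 x ->
    Rabs (U x - partial_sum u m x) <= Series (fun i => M * weight theta (S m + i))).
  { intros m x Hx.
    apply (series_remainder_le (fun j => u j x) (fun j => M * weight theta j));
      [intros j; now apply Hub | exact HM]. }
  assert (Huc : forall j, continuous_on (ray x0) (u j)) by apply Hu.
  assert (HUc : continuous_on (ray x0) U).
  { apply continuous_on_uniform_limit with (partial_sum u).
    - intros m. now apply continuous_on_partial_sum.
    - intros eps Heps. destruct (series_tail_lt _ eps HM Heps) as [m Hm].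
      exists m. intros x Hx. rewrite Rabs_minus_sym.
      eapply Rle_lt_trans; [now apply Hrem | now apply Hm]. }
  pose (G := fun x => N x (U x) * U x + phi x).
  destruct (antiderivative x0 G) as [F HF].
  { apply continuous_on_plus; [|exact phi_cont].
    apply continuous_on_mult; [|exact HUc]. now apply continuous_on_N with a B. }
  pose (E := fun x => F x + (u0 - F x0)).
  assert (HE : forall D x, ray x0 x -> D_in E G D x).
  { intros D x Hx. unfold E.
    apply is_derive_D_in. specialize (HF x). rewrite Rmax_right in HF by exact Hx.
    replace (G x) with (plus (G x) 0) by apply Rplus_0_r.
    apply (is_derive_plus (K := R_AbsRing) (V := R_NormedModule)); [exact HF|].
    apply (is_derive_const (K := R_AbsRing) (V := R_NormedModule)). }
  assert (HE0 : E x0 = u0) by (unfold E; ring).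
  assert (Hsum0 : forall m, partial_sum u m x0 = u0).
  { destruct Hu as [_ [H0 [_ [HS _]]]]. intros m. unfold partial_sum.
    rewrite <- H0. induction m as [|m IH]; [apply sum_O|].
    rewrite sum_Sn, IH, HS. apply Rplus_0_r. }
  (* The derivative of [E - partial_sum u m] is a tail of the series of the
     right-hand sides. *)
  assert (HEm : forall m x, ray x0 x -> Rabs (E x - partial_sum u m x)
      <= Series (fun i => L * weight theta (S m + i)) * (x - x0)).
  { intros m x Hx.
    replace (E x - partial_sum u m x)
      with (E x - partial_sum u m x - (E x0 - partial_sum u m x0))
      by (rewrite Hsum0, HE0; ring).
    apply (mean_value_abs x0 (fun x => E x - partial_sum u m x) x0 x).
    - apply continuous_on_minus; [|now apply continuous_on_partial_sum].
      apply D_in_continuous_on with G. intros z Hz. now apply HE.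
    - apply Rle_refl.
    - intros y Hy. destruct (grid_cell_left_open x0 g y Hg) as [c Hc]; [lra|].
      assert (Hgc := grid_ge x0 g c Hg).
      assert (Hcy : cell g c y) by (split; lra).
      assert (Hyr := cell_ray x0 g c y Hg Hcy).
      exists (G y - sum_n (fun j => FD_rhs N u j (g c) y + first_only (phi y) j) m). split.
      + exists (cell g c), (fun z => G z
          - sum_n (fun j => FD_rhs N u j (g c) z + first_only (phi z) j) m), (g c).
        split; [lra|]. split; [intros z Hz; split; lra|]. split; [|reflexivity].
        apply Dminus; [now apply HE|].
        apply (derivative_on_sum (cell g c) u
          (fun j z => FD_rhs N u j (g c) z + first_only (phi z) j)); [|exact Hcy].
        intros j. now apply (FD_terms_rhs x0 N phi a B a_le_B B_entire N_series u0).
      + replace (G y) with (Series (fun j => FD_rhs N u j (g c) y + first_only (phi y) j)).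
        * apply series_remainder_le with (b := fun j => L * weight theta j);
            [intros j; now apply Hrb | exact HL].
        * apply is_series_unique. unfold G.
          apply (is_series_plus (V := R_NormedModule)).
          -- apply FD_rhs_series; [exact Hyr | now apply Habs | now apply Habs].
          -- assert (H := Series_finite (first_only (phi y)) 0). rewrite sum_O in H.
             apply H. intros [|i] Hi; [lia | reflexivity].
    - unfold ray in Hx. lra. }
  assert (HEU : forall x, ray x0 x -> E x = U x).
  { intros x Hx. apply Rminus_diag_uniq, Rabs_eq_0.
    destruct (Rle_lt_or_eq_dec 0 (Rabs (E x - U x)) (Rabs_pos _)) as [Hd|]; [exfalso|auto].
    set (d := Rabs (E x - U x)) in *.
    assert (Hxx : 0 < 1 + (x - x0)) by (unfold ray in Hx; lra).
    assert (He : 0 < d / (2 * (1 + (x - x0)))) by (apply Rdiv_lt_0_compat; lra).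
    assert (Hd2 : 0 < d / 2) by lra.
    destruct (filter_and _ _ (series_tail_lt _ _ HL He) (series_tail_lt _ _ HM Hd2))
      as [m Hm].
    destruct (Hm m (Nat.le_refl m)) as [H1 H2].
    assert (H3 := HEm m x Hx). assert (H4 := Hrem m x Hx).
    assert (H5 : d <= Rabs (E x - partial_sum u m x) + Rabs (U x - partial_sum u m x)).
    { unfold d. replace (E x - U x)
        with (E x - partial_sum u m x - (U x - partial_sum u m x)) by ring.
      unfold Rminus at 1. eapply Rle_trans; [apply Rabs_triang|].
      rewrite Rabs_Ropp. apply Rle_refl. }
    assert (H6 : Series (fun i => L * weight theta (S m + i)) * (x - x0)
      <= d / (2 * (1 + (x - x0))) * (1 + (x - x0))).
    { unfold ray in Hx.
      apply Rle_trans with (d / (2 * (1 + (x - x0))) * (x - x0)).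
      - apply Rmult_le_compat_r; lra.
      - apply Rmult_le_compat_l; lra. }
    replace (d / (2 * (1 + (x - x0))) * (1 + (x - x0))) with (d / 2) in H6 by (field; lra).
    lra. }
  exists E. split.
  - split; [|exact HE0]. intros x Hx.
    apply derivative_on_ext with (f := E) (d := G); auto.
    + intros y Hy. unfold G. now rewrite HEU.
    + intros y Hy. now apply HE.
  - intros m x Hx. rewrite HEU by exact Hx. now apply Hrem.
Qed.

Context (k alpha : R).
Context (phi_le : forall x, ray x0 x -> Rabs (phi x) <= k).
Context (alpha_gt0 : 0 < alpha).
Context (N_mono : forall x u, ray x0 x -> Derive (fun v => N x v * v) u < - alpha).

Lemma solution_le (u0 : R) (u v : R -> R) :
  solves_cauchy N phi x0 u0 u -> solves_cauchy N phi x0 u0 v ->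
  forall x, ray x0 x -> u x - v x <= 0.
Proof.
  intros [Hu Hu0] [Hv Hv0] x Hx.
  apply (barrier x0 (fun z => u z - v z) x0 x).
  - apply continuous_on_minus; eapply D_in_continuous_on; eassumption.
  - apply Rle_refl.
  - lra.
  - intros y Hy Hpos.
    assert (Hyr : ray x0 y) by (unfold ray; lra).
    apply (D_in_neg_left (fun z => u z - v z)
      (fun z => (N z (u z) * u z + phi z) - (N z (v z) * v z + phi z)) (ray x0) x0 y).
    + apply Dminus; [now apply Hu | now apply Hv].
    + intros z Hz. unfold ray. lra.
    + lra.
    + assert (H := Nu_decreasing x0 N a B a_le_B B_entire N_series alpha N_mono
                     y (v y) (u y) Hyr).
      assert (0 < alpha * (u y - v y)) by (apply Rmult_lt_0_compat; lra). lra.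
  - unfold ray in Hx. lra.
Qed.

Lemma solution_unique (u0 : R) (u v : R -> R) :
  solves_cauchy N phi x0 u0 u -> solves_cauchy N phi x0 u0 v ->
  forall x, ray x0 x -> u x = v x.
Proof.
  intros Hu Hv x Hx.
  assert (H1 := solution_le u0 u v Hu Hv x Hx).
  assert (H2 := solution_le u0 v u Hv Hu x Hx). lra.
Qed.

(** The estimate and the summation together; [r] and [M] are chosen before the grid. *)
Lemma FD_error (u0 : R) : exists r M, 0 < r /\ 0 < M /\
  forall g h v, is_grid x0 g -> 0 < h <= r -> (forall i, g (S i) - g i <= h) ->
    FD_terms N phi x0 u0 g v ->
    exists u, solves_cauchy N phi x0 u0 u /\
      forall m x, ray x0 x ->
        Rabs (u x - partial_sum v m x) <= M * Series (fun i => weight (h / r) (S m + i)).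
Proof.
  assert (Hx0 : ray x0 x0) by apply Rle_refl.
  assert (Hk : 0 <= k) by (eapply Rle_trans; [apply Rabs_pos | now apply (phi_le x0)]).
  pose (M := Rabs u0 + k / alpha + 1).
  assert (Hka : 0 <= k / alpha)
    by (apply Rmult_le_pos; [exact Hk | apply Rlt_le, Rinv_0_lt_compat, alpha_gt0]).
  assert (Hu0 := Rabs_pos u0).
  assert (HM : 1 <= M) by (unfold M; lra).
  assert (HkM : k < alpha * M).
  { replace k with (alpha * (k / alpha)) at 1 by (field; lra).
    apply Rmult_lt_compat_l; [exact alpha_gt0 | unfold M; lra]. }
  pose (sigma := 8 * (1 + M)).
  pose (K := Series (fun n => B n * sigma ^ n)).
  assert (HK : 0 <= K).
  { eapply Rle_trans; [apply Rabs_pos|].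
    apply (Series_abs_le (fun n => a n x0 * sigma ^ n)); [|now apply B_pow_ex].
    apply coef_mult_le; [intros n; now apply a_le_B|].
    intros n. rewrite Rabs_pos_eq; [apply Rle_refl | apply pow_le; unfold sigma; lra]. }
  pose (L := 8 * M * K + k + 1).
  assert (HL : 0 <= L) by (unfold L; nra).
  destruct (small_parameters alpha M K L alpha_gt0 HM HK HL)
    as (delta & r & Hd & Hr & H1 & H2 & H3 & H4 & H5).
  exists r, M. split; [exact Hr|]. split; [lra|].
  intros g h v Hg Hh Hstep Hv.
  assert (Hu0M : Rabs u0 <= M) by (unfold M; lra).
  destruct (FD_sum_solves u0 g v M L (h / r)) as [u [Hu Herr]]; auto.
  - now apply theta_bounds.
  - apply (terms_le x0 N phi a B a_le_B B_entire N_series k alpha phi_le alpha_gt0 N_mono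
      u0 g v Hg Hv M Hu0M HkM HM sigma K L delta r h); auto.
  - apply (rhs_le x0 N phi a B a_le_B B_entire N_series k alpha phi_le alpha_gt0 N_mono
      u0 g v Hg Hv M Hu0M HkM HM sigma K L delta r h); auto.
  - exists u. split; [exact Hu|]. intros m x Hx.
    rewrite <- Series_scal_l. now apply Herr.
Qed.

End Convergence.

Theorem theorem2 (x0 : R) (N : R -> R -> R) (phi : R -> R)
    (a : nat -> R -> R) (B : nat -> R) (k alpha : R)
    (a_cont : forall i, continuous_on (ray x0) (a i))
    (N_series : forall x u : R, ray x0 x -> is_pseries (fun i => a i x) u (N x u))
    (B_ge0 : forall i, 0 <= B i)
    (a_le_B : forall i, Rbar_le (sup_abs x0 (a i)) (B i))
    (B_series : forall u : R, ex_pseries B u)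
    (phi_cont : continuous_on (ray x0) phi)
    (phi_sup : sup_abs x0 phi = Finite k)
    (alpha_gt0 : 0 < alpha)
    (N_mono : forall x u : R, ray x0 x -> Derive (fun v => N x v * v) u < - alpha) :
  forall u0 : R,
    (exists u, solves_cauchy N phi x0 u0 u) /\
    (forall u, solves_cauchy N phi x0 u0 u ->
       FD_converges N phi x0 u0 p_infty u) /\
    exists eps rad C : R, 0 < eps /\ 0 < rad /\ 0 < C /\
      forall u, solves_cauchy N phi x0 u0 u ->
      forall g (h : R), is_grid x0 g -> max_step g = Finite h -> h <= rad ->
        (exists v, FD_terms N phi x0 u0 g v) /\
        forall v, FD_terms N phi x0 u0 g v -> forall m : nat,
          (h < rad ->
             Rbar_le (sup_abs x0 (fun x => u x - partial_sum v m x))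
               (C / Rpower (1 + INR m) (1 + eps)
                * ((h / rad) ^ (m + 1) / (1 - h / rad)))) /\
          (h = rad ->
             Rbar_le (sup_abs x0 (fun x => u x - partial_sum v m x))
               (C * Series (fun j =>
                      / Rpower (INR (m + 1 + j) + 1) (1 + eps)))).
Proof.
  intros u0.
  assert (Ha : forall i x, ray x0 x -> Rabs (a i x) <= B i).
  { intros i x Hx. now apply (le_sup_abs x0). }
  assert (Hphi : forall x, ray x0 x -> Rabs (phi x) <= k).
  { intros x Hx. apply (le_sup_abs x0); [|exact Hx]. rewrite phi_sup. apply Rle_refl. }
  destruct (FD_error x0 N phi a B a_cont Ha B_series N_series phi_cont k alpha Hphi
              alpha_gt0 N_mono u0) as (r & M & Hr & HM & Herr).
  assert (Hex : forall g, is_grid x0 g -> exists v, FD_terms N phi x0 u0 g v).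
  { intros g Hg. now apply FD_exists with a B. }
  assert (Hall : forall u, solves_cauchy N phi x0 u0 u ->
    forall g h v, is_grid x0 g -> 0 < h <= r -> (forall i, g (S i) - g i <= h) ->
    FD_terms N phi x0 u0 g v -> forall m x, ray x0 x ->
      Rabs (u x - partial_sum v m x) <= M * Series (fun i => weight (h / r) (S m + i))).
  { intros u Hu g h v Hg Hh Hstep Hv m x Hx.
    destruct (Herr g h v Hg Hh Hstep Hv) as [w [Hw Hwm]].
    rewrite (solution_unique x0 N phi a B Ha B_series N_series alpha alpha_gt0 N_mono
               u0 u w Hu Hw x Hx).
    now apply Hwm. }
  split; [|split].
  - destruct (Hex _ (uniform_grid x0 r Hr)) as [v Hv].
    destruct (Herr (fun i => x0 + r * INR i) r v) as [u [Hu _]];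
      [now apply uniform_grid | lra | | exact Hv | now exists u].
    intros i. rewrite S_INR. lra.
  - intros u Hu. exists r. split; [exact Hr|]. intros g Hg Hstep.
    split; [now apply Hex|]. intros v Hv eps Heps.
    assert (HW : ex_series (fun j => M * weight 1 j))
      by (apply (ex_series_scal (V := R_NormedModule)), ex_series_weight; lra).
    generalize (series_tail_lt _ eps HW Heps). apply filter_imp.
    intros m Hm x [Hx _]. rewrite Rabs_minus_sym.
    eapply Rle_lt_trans; [|exact Hm]. rewrite Series_scal_l.
    replace 1 with (r / r) by (field; lra).
    apply (Hall u Hu g r v Hg); [lra | | exact Hv | exact Hx].
    intros i. now apply max_step_ge.
  - exists 1, r, M. split; [lra|]. split; [exact Hr|]. split; [exact HM|].
    intros u Hu g h Hg Hstep Hh.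
    assert (Hsteps : forall i, g (S i) - g i <= h).
    { intros i. apply max_step_ge. rewrite Hstep. apply Rle_refl. }
    assert (Hh0 : 0 < h).
    { assert (H1 := Hsteps 0%nat). assert (H2 := proj1 (proj2 Hg) 0%nat). lra. }
    split; [now apply Hex|]. intros v Hv m. split; intros Hhr; apply sup_abs_le; intros x Hx.
    + eapply Rle_trans; [now apply (Hall u Hu g h v)|].
      replace (M / Rpower (1 + INR m) (1 + 1) * ((h / r) ^ (m + 1) / (1 - h / r)))
        with (M * (/ Rpower (1 + INR m) (1 + 1) * ((h / r) ^ (m + 1) / (1 - h / r))))
        by (unfold Rdiv; ring).
      apply Rmult_le_compat_l; [lra|].
      apply weight_tail_lt_one. destruct (theta_bounds r h) as [H1 H2]; [lra | lra|].
      split; [exact H1|]. unfold Rdiv. rewrite <- (Rinv_r r) by lra.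
      apply Rmult_lt_compat_r; [now apply Rinv_0_lt_compat | exact Hhr].
    + eapply Rle_trans; [now apply (Hall u Hu g h v)|].
      rewrite Hhr. replace (r / r) with 1 by (field; lra).
      rewrite weight_tail_one. apply Rle_refl.
Qed.
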